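(* Let $\mathbb{M}=(M_p)_{p\in\mathbb{N}_0}$ be a weight sequence. (i) Let $\alpha>0$, $\alpha\notin\mathbb{N}$, be such that $\widetilde{\mathcal{B}}:\widetilde{\mathcal{A}}_{\mathbb{M}}(S_\alpha)\to\mathbb{C}[[z]]_{\mathbb{M}}$ is surjective. Then $\gamma(\mathbb{M})>\lfloor\alpha\rfloor$. (ii) If $\widetilde{S}_{\mathbb{M}}=(0,\infty)$, then $\gamma(\mathbb{M})=\infty$.
   Context: Sequences. $\mathbb{N}=\{1,2,\dots\}$, $\mathbb{N}_0=\mathbb{N}\cup\{0\}$. A weight sequence is a sequence $\mathbb{M}=(M_p)_{p\in\mathbb{N}_0}$ of positive reals with $M_0=1$, logarithmically convex ($M_p^2\le M_{p-1}M_{p+1}$ for $p\ge1$), whose sequence of quotients $m_p:=M_{p+1}/M_p$ tends to $\infty$. For $\gamma\in\mathbb{R}$, $\mathbb{M}$ satisfies $(P_\gamma)$ if there are a real sequence $(m'_p)_{p\in\mathbb{N}_0}$ and $a\ge1$ with $a^{-1}m_p\le m'_p\le am_p$ for $p\ge 1$ and $((p+1)^{-\gamma}m'_p)_{p\in\mathbb{N}_0}$ increasing; $\gamma(\mathbb{M}):=\sup\{\gamma\in\mathbb{R}:(P_\gamma)\text{ holds}\}\in[0,\infty]$. (Equivalently, for a weight sequence, $\gamma(\mathbb{M})$ is the supremum, $0$ if the set is empty, of the $\gamma>0$ for which there is $a>0$ with $m_p/(p+1)^\gamma\le a\,m_q/(q+1)^\gamma$ for all $q\ge p$.) Sectors.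 $\mathcal{R}$ is the Riemann surface of the logarithm. For $\gamma>0$, $S_\gamma=\{z\in\mathcal{R}:|\arg z|<\gamma\pi/2\}$. A bounded sector $T=\{z\in\mathcal{R}:|\arg z-d|<\alpha\pi/2,\ |z|<r\}$ is a proper subsector of $S_\gamma$, written $T\ll S_\gamma$, if its closure in $\mathcal{R}$ (so the vertex $0$ is not considered) is contained in $S_\gamma$. Classes. $\widetilde{\mathcal{A}}_{\mathbb{M}}(S_\gamma)$ is the space of holomorphic $f:S_\gamma\to\mathbb{C}$ for which there is a (necessarily unique) formal series $\widehat f=\sum_{p\ge0}a_pz^p$ such that for every $T\ll S_\gamma$ there are $C_T,A_T>0$ with $|f(z)-\sum_{n=0}^{p-1}a_nz^n|\le C_TA_T^pM_p|z|^p$ for all $z\in T$, $p\in\mathbb{N}_0$. $\mathbb{C}[[z]]_{\mathbb{M}}$ is the set of $\sum a_pz^p\in\mathbb{C}[[z]]$ for which there is $A>0$ with $\sup_p|a_p|/(A^pM_p)<\infty$. The asymptotic Borel map is $\widetilde{\mathcal{B}}(f)=\widehat f$. $\widetilde{S}_{\mathbb{M}}$ is the set of $\gamma>0$ such that $\widetilde{\mathcal{B}}:\widetilde{\mathcal{A}}_{\mathbb{M}}(S_\gamma)\to\mathbb{C}[[z]]_{\mathbb{M}}$ is surjective. *)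

(* Defs.v *)
From Stdlib Require Import Reals Lra Lia Psatz Arith Wf_nat Zfloor.
From Coquelicot Require Import Coquelicot.

Open Scope R_scope.

Definition quotient (M : nat -> R) (p : nat) : R := M (S p) / M p.

Definition weight_sequence (M : nat -> R) : Prop :=
  (forall p, 0 < M p) /\
  M 0%nat = 1 /\
  (forall p, (1 <= p)%nat -> (M p) ^ 2 <= M (p - 1)%nat * M (p + 1)%nat) /\
  is_lim_seq (quotient M) p_infty.

(* "Increasing" means nondecreasing; the value m' 0 is only constrained
   through monotonicity. *)
Definition property_P (M : nat -> R) (gamma : R) : Prop :=
  exists (m' : nat -> R) (a : R),
    1 <= a /\
    (forall p, (1 <= p)%nat ->
       / a * quotient M p <= m' p /\ m' p <= a * quotient M p) /\
    (forall p q, (p <= q)%nat ->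
       Rpower (INR p + 1) (- gamma) * m' p
       <= Rpower (INR q + 1) (- gamma) * m' q).

Definition gamma_index (M : nat -> R) : Rbar := Lub_Rbar (property_P M).

(* A point z of the Riemann surface of the logarithm is the pair (|z|, arg z)
   with 0 < |z| and arg z any real number.  The pairs with fst z <= 0 are not
   points of the surface: every set below excludes them. *)
Notation logpt := (R * R)%type.

Definition on_surface (z : logpt) : Prop := 0 < fst z.

Definition proj (z : logpt) : C :=
  (fst z * cos (snd z), fst z * sin (snd z)).

Definition sector (gamma : R) (z : logpt) : Prop :=
  on_surface z /\ Rabs (snd z) < gamma * PI / 2.

Definition bounded_sector (d alpha r : R) (z : logpt) : Prop :=
  on_surface z /\ Rabs (snd z - d) < alpha * PI / 2 /\ fst z < r.

Definition surface_closure (T : logpt -> Prop) (z : logpt) : Prop :=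
  on_surface z /\
  forall V : logpt -> Prop, locally z V -> exists w, V w /\ T w.

Definition proper_subsector (d alpha r gamma : R) : Prop :=
  0 < alpha /\ 0 < r /\
  forall z, surface_closure (bounded_sector d alpha r) z -> sector gamma z.

(* Complex differentiability in the local charts given by proj, which is a
   local homeomorphism on the surface. *)
Definition holomorphic_on (U : logpt -> Prop) (f : logpt -> C) : Prop :=
  forall z0, U z0 ->
  exists l : C,
    filterlim (fun z => ((f z - f z0) / (proj z - proj z0))%C)
      (locally' z0) (locally l).

Fixpoint partial_sum (a : nat -> C) (p : nat) (z : C) : C :=
  match p with
  | O => RtoC 0
  | S n => (partial_sum a n z + a n * z ^ n)%C
  end.

(* [borel_image M gamma f a]: the formal series with coefficients a is the
   image of f under the Borel map.  It is unique by [borel_image_unique]. *)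
Definition borel_image (M : nat -> R) (gamma : R) (f : logpt -> C)
    (a : nat -> C) : Prop :=
  forall d alpha r, proper_subsector d alpha r gamma ->
  exists CT AT : R, 0 < CT /\ 0 < AT /\
    forall z p, bounded_sector d alpha r z ->
      Cmod (f z - partial_sum a p (proj z))%C
      <= CT * AT ^ p * M p * fst z ^ p.

Definition asymptotic_class (M : nat -> R) (gamma : R) (f : logpt -> C) : Prop :=
  holomorphic_on (sector gamma) f /\ exists a, borel_image M gamma f a.

Definition formal_class (M : nat -> R) (a : nat -> C) : Prop :=
  exists A : R, 0 < A /\
  exists K : R, forall p, Cmod (a p) / (A ^ p * M p) <= K.

Definition borel_surjective (M : nat -> R) (gamma : R) : Prop :=
  forall a, formal_class M a ->
  exists f, asymptotic_class M gamma f /\ borel_image M gamma f a.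

Definition surjectivity_set (M : nat -> R) (gamma : R) : Prop :=
  0 < gamma /\ borel_surjective M gamma.

Lemma proper_subsector_half (gamma : R) :
  0 < gamma -> proper_subsector 0 (gamma / 2) 1 gamma.
Proof.
intros Hg. pose proof PI_RGT_0 as HPI.
assert (Hpos : 0 < gamma * PI) by nra.
split; [lra | split; [lra |]].
intros [r t] [Hr Hc]. split; [exact Hr |]. simpl.
assert (He : 0 < gamma * PI / 4) by lra.
destruct (Hc (ball ((r, t) : logpt) (mkposreal _ He)))
  as [[r' t'] [[_ Hb] [_ [Hw _]]]].
{ apply locally_ball. }
change (Rabs (t' - t) < gamma * PI / 4) in Hb. simpl in Hw.
apply Rabs_def2 in Hb. apply Rabs_def2 in Hw.
apply Rabs_def1; lra.
Qed.

Lemma borel_image_unique (M : nat -> R) (gamma : R) (f : logpt -> C)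
    (a b : nat -> C) :
  (forall p, 0 < M p) -> 0 < gamma ->
  borel_image M gamma f a -> borel_image M gamma f b -> forall p, a p = b p.
Proof.
intros HM Hg Ha Hb.
destruct (Ha _ _ _ (proper_subsector_half gamma Hg)) as [C1 [A1 [HC1 [HA1 H1]]]].
destruct (Hb _ _ _ (proper_subsector_half gamma Hg)) as [C2 [A2 [HC2 [HA2 H2]]]].
intros p. induction p as [p IH] using lt_wf_ind.
assert (Heq : forall z, partial_sum a p z = partial_sum b p z).
{ intros z. clear - IH. induction p as [|p IHp]; [reflexivity |]. simpl.
  rewrite IHp by (intros; apply IH; lia). rewrite (IH p) by lia. reflexivity. }
set (K1 := C1 * A1 ^ S p * M (S p)). set (K2 := C2 * A2 ^ S p * M (S p)).
assert (HK : 0 < K1 + K2).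
{ unfold K1, K2. pose proof (HM (S p)). pose proof (pow_lt A1 (S p) HA1).
  pose proof (pow_lt A2 (S p) HA2).
  apply Rplus_lt_0_compat; repeat (assumption || apply Rmult_lt_0_compat). }
assert (Hbound : forall r, 0 < r < 1 -> Cmod (a p - b p)%C <= (K1 + K2) * r).
{ intros r Hr.
  assert (Hz : bounded_sector 0 (gamma / 2) 1 (r, 0)).
  { split; [exact (proj1 Hr) | split; [| exact (proj2 Hr)]]. simpl.
    rewrite Rminus_0_r, Rabs_R0. pose proof PI_RGT_0. nra. }
  assert (Hp : proj (r, 0) = RtoC r).
  { unfold proj, RtoC; simpl. rewrite cos_0, sin_0. f_equal; ring. }
  specialize (H1 _ (S p) Hz). specialize (H2 _ (S p) Hz).
  rewrite Hp in H1, H2. cbn [fst partial_sum] in H1, H2.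
  rewrite Heq in H1. fold K1 in H1. fold K2 in H2.
  set (s := partial_sum b p (RtoC r)) in *.
  assert (Ht : Cmod ((a p - b p) * RtoC r ^ p)%C <= (K1 + K2) * r ^ S p).
  { replace ((a p - b p) * RtoC r ^ p)%C
      with ((f (r, 0) - (s + b p * RtoC r ^ p))
            + - (f (r, 0) - (s + a p * RtoC r ^ p)))%C by ring.
    eapply Rle_trans; [apply Cmod_triangle |]. rewrite Cmod_opp. lra. }
  assert (Hm : Cmod (RtoC r ^ p)%C = r ^ p).
  { clear - Hr. induction p as [|p IHp]; [apply Cmod_1 |].
    rewrite Cpow_S, Cmod_mult, IHp, Cmod_R, Rabs_pos_eq by lra. reflexivity. }
  rewrite Cmod_mult, Hm in Ht. pose proof (pow_lt r p (proj1 Hr)) as Hrp.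
  simpl in Ht. apply Rmult_le_reg_r with (r ^ p); [assumption |]. lra. }
assert (H0 : Cmod (a p - b p)%C = 0).
{ apply Rle_antisym; [| apply Cmod_ge_0].
  destruct (Rle_or_lt (Cmod (a p - b p)%C) 0) as [| Hlt]; [assumption |].
  exfalso. set (c := Cmod (a p - b p)%C) in *.
  set (r := Rmin (/ 2) (c / (2 * (K1 + K2)))).
  assert (Hd : 0 < c / (2 * (K1 + K2))) by (apply Rdiv_lt_0_compat; lra).
  assert (Hr : 0 < r < 1).
  { split; [apply Rmin_pos; lra |].
    eapply Rle_lt_trans; [apply Rmin_l |]. lra. }
  specialize (Hbound r Hr).
  assert (Hr2 : (K1 + K2) * r <= (K1 + K2) * (c / (2 * (K1 + K2)))).
  { apply Rmult_le_compat_l; [lra | apply Rmin_r]. }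
  replace ((K1 + K2) * (c / (2 * (K1 + K2)))) with (c / 2) in Hr2
    by (field; lra).
  lra. }
apply Cmod_eq_0 in H0.
replace (a p) with ((a p - b p) + b p)%C by ring. rewrite H0. ring.
Qed.

(* Main.v *)
(* Surjectivity yields property (P_beta) for every beta < alpha.  By a Baire
   argument on the sequences with entries 0 or M_j there are k and, for all
   large p and all q > 2p, a function g on the sector whose expansion agrees
   with M_{2p} z^{2p} up to order q, with remainders of order j bounded by
   2 k^{j+1} M_j |z|^j.  At x = A / m_p with A large, the bound of order p shows
   that |g(x)| is at most half of M_{2p} x^{2p}, so the remainder
   G = g - M_{2p} z^{2p} is not small there.  On the other hand
   G / (M_{2p} z^{2p}) is O(k^{2p}) everywhere and O((k m_q |z|)^{q-2p}) near the
   vertex.  Flattening the sector of opening beta to a half-plane by z^{1/beta},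
   a two-constants estimate turns this into
   (q - 2p) (m_p / m_q)^{1/beta} = O(p), which says that m_p / (p+1)^beta is
   almost increasing. *)
Require Import Defs.
From Stdlib Require Import Reals Lra Lia Psatz ZArith ClassicalEpsilon Zfloor.
From Coquelicot Require Import Coquelicot.

Open Scope R_scope.

(** The Baire sets are used only through density in a cylinder, never through closedness, so no
    compactness theorem for holomorphic functions enters. A sequence is then merely matched up to
    order q. This is why g depends on q, and it is harmless because the inequality sought concerns
    one pair p, q at a time. The monomial has degree 2p so that two orders can be compared:
    log-convexity gives M_{2p} x^{2p} >= (m_p x)^p M_p x^p, and the factor (m_p x)^p = A^p beats the
    2 k^{p+1} of the order-p bound. The two bounds for G lose only a factor exponential in p, hence
    O(p) after taking logarithms. The gain is (q - 2p) times a quantity comparable to the harmonic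
    measure of a boundary segment of size b seen from a point of the half-plane at distance X >= b.
    Being linear in b / X, it yields exactly the power (m_p / m_q)^{1/beta}. An explicit rational
    function replaces this harmonic measure, and in the coordinate log z the sector is a strip, so
    the maximum modulus principle on rectangles suffices. *)

(** * Complex differentiability *)

Notation cderiv := (@is_derive C_AbsRing (AbsRing_NormedModule C_AbsRing)).

Lemma cderiv_eps (f : C -> C) (z l : C) :
  cderiv f z l <->
  forall eps, 0 < eps -> exists delta, 0 < delta /\
    forall w, Cmod (w - z) < delta ->
      Cmod (f w - f z - l * (w - z)) <= eps * Cmod (w - z).
Proof.
split.
- intros [_ H] eps He.
  destruct (H z (fun P HP => HP) (mkposreal eps He)) as [d Hd].
  exists d; split; [apply cond_pos |].
  intros w Hw. specialize (Hd w Hw).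
  rewrite (Cmult_comm l). exact Hd.
- intros H. split; [apply (is_linear_scal_l (K := C_AbsRing)) |].
  intros y Hy. apply (@is_filter_lim_locally_unique C_AbsRing (AbsRing_NormedModule C_AbsRing)) in Hy.
  subst y.
  intros eps. destruct (H eps (cond_pos eps)) as [d [Hd Hw]].
  exists (mkposreal d Hd). intros w Hw'. specialize (Hw w Hw').
  rewrite (Cmult_comm l) in Hw. exact Hw.
Qed.

Lemma cderiv_continuous (f : C -> C) (z l : C) :
  cderiv f z l ->
  forall eps, 0 < eps -> exists delta, 0 < delta /\
    forall w, Cmod (w - z) < delta -> Cmod (f w - f z) < eps.
Proof.
intros H eps He.
destruct (proj1 (cderiv_eps f z l) H 1 Rlt_0_1) as [d [Hd Hw]].
pose proof (Cmod_ge_0 l) as Hl.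
exists (Rmin d (eps / (2 + Cmod l))). split.
{ apply Rmin_pos; [assumption |]. apply Rdiv_lt_0_compat; lra. }
intros w Hz.
assert (Hz1 := Rlt_le_trans _ _ _ Hz (Rmin_l _ _)).
assert (Hz2 := Rlt_le_trans _ _ _ Hz (Rmin_r _ _)).
specialize (Hw w Hz1).
replace (f w - f z)%C with ((f w - f z - l * (w - z)) + l * (w - z))%C by ring.
eapply Rle_lt_trans; [apply Cmod_triangle |]. rewrite Cmod_mult.
assert (Cmod (w - z) * (2 + Cmod l) < eps).
{ apply Rmult_lt_reg_r with (/ (2 + Cmod l)); [apply Rinv_0_lt_compat; lra |].
  rewrite Rmult_assoc, Rinv_r by lra. lra. }
pose proof (Cmod_ge_0 (w - z)). nra.
Qed.

Definition cdiff (f : C -> C) (z : C) : Prop := exists l, cderiv f z l.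

Lemma cdiff_const (c z : C) : cdiff (fun _ => c) z.
Proof. exists zero. apply (is_derive_const (K := C_AbsRing)). Qed.

Lemma cdiff_id (z : C) : cdiff (fun w => w) z.
Proof. exists one. apply (is_derive_id (K := C_AbsRing)). Qed.

Lemma cdiff_plus (f g : C -> C) (z : C) :
  cdiff f z -> cdiff g z -> cdiff (fun w => f w + g w)%C z.
Proof.
intros [l Hl] [m Hm]. exists (plus l m).
exact (is_derive_plus (K := C_AbsRing) _ _ _ _ _ Hl Hm).
Qed.

Lemma cdiff_mult (f g : C -> C) (z : C) :
  cdiff f z -> cdiff g z -> cdiff (fun w => f w * g w)%C z.
Proof.
intros [l Hl] [m Hm]. eexists.
exact (is_derive_mult (K := C_AbsRing) _ _ _ _ _ Hl Hm Cmult_comm).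
Qed.

Lemma cdiff_comp (f g : C -> C) (z : C) :
  cdiff f (g z) -> cdiff g z -> cdiff (fun w => f (g w)) z.
Proof.
intros [l Hl] [m Hm]. eexists.
exact (is_derive_comp (K := C_AbsRing) _ _ _ _ _ Hl Hm).
Qed.

Lemma cdiff_minus (f g : C -> C) (z : C) :
  cdiff f z -> cdiff g z -> cdiff (fun w => f w - g w)%C z.
Proof.
intros [l Hl] [m Hm]. eexists.
exact (is_derive_minus (K := C_AbsRing) _ _ _ _ _ Hl Hm).
Qed.

Lemma cdiff_pow (f : C -> C) (n : nat) (z : C) :
  cdiff f z -> cdiff (fun w => f w ^ n)%C z.
Proof.
intros Hf. induction n as [|n IH]; simpl.
- apply cdiff_const.
- apply cdiff_mult; assumption.
Qed.

Lemma cdiff_inv (z : C) : z <> 0 -> cdiff (fun w => / w)%C z.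
Proof.
intros Hz. exists (- / (z * z))%C. apply cderiv_eps. intros eps He.
assert (Hm : 0 < Cmod z) by (apply Cmod_gt_0; exact Hz).
set (r := Cmod z) in *.
(* The remainder is (w - z)^2 / (w z^2). The first bound gives |w| > r / 2, the second then makes it
   at most eps |w - z|. *)
exists (Rmin (r / 2) (eps * r ^ 3 / 2)). split.
{ apply Rmin_pos; [lra |]. pose proof (pow_lt r 3 Hm). nra. }
intros w Hw.
assert (H1 := Rlt_le_trans _ _ _ Hw (Rmin_l _ _)).
assert (H2 := Rlt_le_trans _ _ _ Hw (Rmin_r _ _)). clear Hw.
assert (Hwr : r / 2 < Cmod w).
{ pose proof (Cmod_triangle w (- (w - z))) as Ht. rewrite Cmod_opp in Ht.
  replace (w + - (w - z))%C with z in Ht by ring. fold r in Ht. lra. }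
assert (Hw0 : w <> 0). { apply Cmod_gt_0. lra. }
replace (/ w - / z - - / (z * z) * (w - z))%C
  with ((w - z) * ((w - z) / (w * (z * z))))%C by (field; split; assumption).
rewrite Cmod_mult, Rmult_comm. apply Rmult_le_compat_r; [apply Cmod_ge_0 |].
assert (Hn : (w * (z * z))%C <> 0).
{ apply Cmod_gt_0. rewrite !Cmod_mult. fold r.
  apply Rmult_lt_0_compat; [lra | nra]. }
rewrite Cmod_div by exact Hn. rewrite !Cmod_mult. fold r.
apply Rle_div_l; [apply Rmult_lt_0_compat; nra |].
assert (eps * r ^ 3 / 2 <= eps * (Cmod w * (r * r))).
{ simpl. assert (0 <= eps * (r * r) * (Cmod w - r / 2)); [| nra].
  apply Rmult_le_pos; [apply Rmult_le_pos; nra | lra]. }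
lra.
Qed.

(** * Bisection of rectangles *)

Lemma nested_intervals (x y : nat -> R) :
  (forall n, x n <= x (S n)) -> (forall n, y (S n) <= y n) ->
  (forall n, x n <= y n) -> exists z, forall n, x n <= z <= y n.
Proof.
intros Hx Hy Hxy.
assert (Hxm : forall m n, (m <= n)%nat -> x m <= x n).
{ intros m n H. induction H; [lra |]. specialize (Hx m0). lra. }
assert (Hym : forall m n, (m <= n)%nat -> y n <= y m).
{ intros m n H. induction H; [lra |]. specialize (Hy m0). lra. }
assert (Hall : forall m n, x m <= y n).
{ intros m n. destruct (Nat.le_ge_cases m n) as [H | H].
  - specialize (Hxm _ _ H). specialize (Hxy n). lra.
  - specialize (Hym _ _ H). specialize (Hxy m). lra. }
destruct (completeness (fun r => exists n, r = x n)) as [z [Hz1 Hz2]].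
- exists (y 0%nat). intros r [n ->]. apply Hall.
- exists (x 0%nat), 0%nat. reflexivity.
- exists z. intros n. split; [apply Hz1; eauto |].
  apply Hz2. intros r [m ->]. apply Hall.
Qed.

Lemma half_pow_small (x delta : R) :
  0 < delta -> exists n, x * / 2 ^ n < delta.
Proof.
intros Hd.
destruct (Pow_x_infinity 2 ltac:(rewrite Rabs_pos_eq; lra) (Rabs x / delta + 1))
  as [n Hn].
exists n. specialize (Hn n (le_n n)).
pose proof (pow_lt 2 n Rlt_0_2) as Hp. rewrite Rabs_pos_eq in Hn by lra.
apply Rlt_div_l; [exact Hp |].
assert (Rabs x / delta * delta = Rabs x) by (field; lra).
pose proof (Rle_abs x). nra.
Qed.

(** Compactness in the form of bisection: if the property failed, it would fail on nested rectangles
    of halving size, which shrink to a point where the local hypothesis applies. *)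
Lemma rectangle_induction (P : R -> R -> R -> R -> Prop) (a b c d : R) :
  a <= b -> c <= d ->
  (forall a b c d, a <= b -> c <= d ->
     P a ((a + b) / 2) c ((c + d) / 2) -> P ((a + b) / 2) b c ((c + d) / 2) ->
     P a ((a + b) / 2) ((c + d) / 2) d -> P ((a + b) / 2) b ((c + d) / 2) d ->
     P a b c d) ->
  (forall x y, a <= x <= b -> c <= y <= d -> exists delta, 0 < delta /\
     forall a' b' c' d', a <= a' <= x -> x <= b' <= b ->
       c <= c' <= y -> y <= d' <= d ->
       b' - a' < delta -> d' - c' < delta -> P a' b' c' d') ->
  P a b c d.
Proof.
intros Hab Hcd Hq Hloc.
destruct (classic (P a b c d)) as [|Hn]; [assumption | exfalso].
pose (bad := fun q : (R * R) * (R * R) =>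
  fst (fst q) <= snd (fst q) /\ fst (snd q) <= snd (snd q) /\
  ~ P (fst (fst q)) (snd (fst q)) (fst (snd q)) (snd (snd q))).
pose (half := fun q r : (R * R) * (R * R) =>
  fst (fst q) <= fst (fst r) /\ snd (fst r) <= snd (fst q) /\
  fst (snd q) <= fst (snd r) /\ snd (snd r) <= snd (snd q) /\
  snd (fst r) - fst (fst r) = (snd (fst q) - fst (fst q)) / 2 /\
  snd (snd r) - fst (snd r) = (snd (snd q) - fst (snd q)) / 2).
(* The implication stands under the existential so that choice gives a total map [next]; a [q] that
   is not bad receives the null rectangle as a default. *)
assert (Hstep : forall q, exists r, bad q -> bad r /\ half q r).
{ intros [[a0 b0] [c0 d0]]. unfold bad, half; simpl.
  destruct (classic (a0 <= b0 /\ c0 <= d0 /\ ~ P a0 b0 c0 d0)) as [[Ha [Hc HP]] | Hf];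
    [| exists ((0, 0), (0, 0)); intros; contradiction].
  destruct (classic (P a0 ((a0 + b0) / 2) c0 ((c0 + d0) / 2))) as [H1 |];
    [| exists ((a0, (a0 + b0) / 2), (c0, (c0 + d0) / 2)); simpl; intros _;
       repeat split; try assumption; lra].
  destruct (classic (P ((a0 + b0) / 2) b0 c0 ((c0 + d0) / 2))) as [H2 |];
    [| exists (((a0 + b0) / 2, b0), (c0, (c0 + d0) / 2)); simpl; intros _;
       repeat split; try assumption; lra].
  destruct (classic (P a0 ((a0 + b0) / 2) ((c0 + d0) / 2) d0)) as [H3 |];
    [| exists ((a0, (a0 + b0) / 2), ((c0 + d0) / 2, d0)); simpl; intros _;
       repeat split; try assumption; lra].
  destruct (classic (P ((a0 + b0) / 2) b0 ((c0 + d0) / 2) d0)) as [H4 |];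
    [| exists (((a0 + b0) / 2, b0), ((c0 + d0) / 2, d0)); simpl; intros _;
       repeat split; try assumption; lra].
  exfalso. apply HP, Hq; assumption. }
pose (next := fun q => proj1_sig (constructive_indefinite_description _ (Hstep q))).
assert (Hnext : forall q, bad q -> bad (next q) /\ half q (next q)).
{ intros q. unfold next. exact (proj2_sig (constructive_indefinite_description _ (Hstep q))). }
pose (u := fix u n := match n with O => ((a, b), (c, d)) | S m => next (u m) end).
assert (Hbad : forall n, bad (u n)).
{ induction n as [|n IH]; [unfold bad; simpl; tauto | apply Hnext, IH]. }
assert (Hhalf : forall n, half (u n) (u (S n))) by (intros n; apply Hnext, Hbad).
destruct (nested_intervals (fun n => fst (fst (u n))) (fun n => snd (fst (u n))))
  as [x Hx]; try (intros n; apply Hhalf || apply Hbad).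
destruct (nested_intervals (fun n => fst (snd (u n))) (fun n => snd (snd (u n))))
  as [y Hy]; try (intros n; apply Hhalf || apply Hbad).
assert (Hin : forall n, a <= fst (fst (u n)) /\ snd (fst (u n)) <= b /\ c <= fst (snd (u n)) /\ snd (snd (u n)) <= d).
{ induction n as [|n IH]; [simpl; lra |]. pose proof (Hhalf n) as Hh.
  unfold half in Hh. lra. }
assert (Hsz : forall n, snd (fst (u n)) - fst (fst (u n)) = (b - a) * / 2 ^ n /\
  snd (snd (u n)) - fst (snd (u n)) = (d - c) * / 2 ^ n).
{ induction n as [|n IH]; [simpl; lra |].
  destruct (Hhalf n) as [_ [_ [_ [_ [E1 E2]]]]].
  rewrite E1, E2, (proj1 IH), (proj2 IH).
  assert (2 ^ n <> 0) by (apply pow_nonzero; lra).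
  split; rewrite <- tech_pow_Rmult; field; assumption. }
destruct (Hloc x y) as [delta [Hd HP]].
{ specialize (Hx 0%nat); exact Hx. }
{ specialize (Hy 0%nat); exact Hy. }
destruct (half_pow_small ((b - a) + (d - c)) delta Hd) as [n Hsmall].
assert (H2 : 0 < / 2 ^ n) by (apply Rinv_0_lt_compat, pow_lt; lra).
specialize (Hx n). specialize (Hy n). specialize (Hin n).
destruct (Hsz n) as [S1 S2].
apply (proj2 (proj2 (Hbad n))), HP; try lra; rewrite ?S1, ?S2; nra.
Qed.

(** * Contour integrals and Goursat's theorem *)

(* Imaginary part of the integral of H(z) dz around [a, b] x [c, d]. *)
Definition contour_Im (a b c d : R) (H : C -> C) : R :=
  RInt (fun s => Im (H (s, c))) a b - RInt (fun s => Im (H (s, d))) a b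
  + RInt (fun t => Re (H (b, t))) c d - RInt (fun t => Re (H (a, t))) c d.

Definition in_rectangle (a b c d : R) (z : C) : Prop :=
  a <= fst z <= b /\ c <= snd z <= d.

Definition cdiff_on (a b c d : R) (H : C -> C) : Prop :=
  forall z, in_rectangle a b c d z -> cdiff H z.

Lemma Cmod_le_sum (z : C) : Cmod z <= Rabs (fst z) + Rabs (snd z).
Proof.
replace z with ((RtoC (fst z)) + Ci * RtoC (snd z))%C at 1
  by (destruct z; unfold Ci, RtoC, Cplus, Cmult; simpl; f_equal; ring).
eapply Rle_trans; [apply Cmod_triangle |].
rewrite Cmod_mult, Cmod_Ci, !Cmod_R. lra.
Qed.

Lemma im_le_Cmod (z : C) : Rabs (Im z) <= Cmod z.
Proof. eapply Rle_trans; [| apply Rmax_Cmod]. apply Rmax_r. Qed.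

Lemma cdiff_continuous_slice (H : C -> C) (g : R -> C) (x : R) :
  (forall y, Cmod (g y - g x) = Rabs (y - x)) -> cdiff H (g x) ->
  continuous (fun y => Re (H (g y))) x /\ continuous (fun y => Im (H (g y))) x.
Proof.
intros Hg [l Hl].
assert (K := cderiv_continuous _ _ _ Hl).
split; apply continuity_pt_filterlim; intros eps He;
  destruct (K eps He) as [delta [Hd Hw]]; exists delta; (split; [exact Hd |]);
  intros y [_ Hy]; simpl in Hy |- *; unfold Rdist in *;
  rewrite <- Hg in Hy; specialize (Hw _ Hy).
- eapply Rle_lt_trans; [| exact Hw].
  exact (re_le_Cmod (H (g y) - H (g x))%C).
- eapply Rle_lt_trans; [| exact Hw].
  exact (im_le_Cmod (H (g y) - H (g x))%C).
Qed.

Lemma Cmod_horizontal (y : R) (s s' : R) : Cmod ((s', y) - (s, y))%C = Rabs (s' - s).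
Proof.
replace ((s', y) - (s, y))%C with (RtoC (s' - s)); [apply Cmod_R |].
unfold RtoC, Cminus, Cplus, Copp; simpl. f_equal; ring.
Qed.

Lemma Cmod_vertical (x : R) (t t' : R) : Cmod ((x, t') - (x, t))%C = Rabs (t' - t).
Proof.
replace ((x, t') - (x, t))%C with (Ci * RtoC (t' - t))%C.
- rewrite Cmod_mult, Cmod_Ci, Cmod_R. ring.
- unfold RtoC, Ci, Cmult, Cminus, Cplus, Copp; simpl. f_equal; ring.
Qed.

Lemma ex_RInt_horizontal (H : C -> C) (y a b : R) :
  a <= b -> (forall s, a <= s <= b -> cdiff H (s, y)) ->
  ex_RInt (fun s => Im (H (s, y))) a b.
Proof.
intros Hab Hd. apply (ex_RInt_continuous (V := R_CompleteNormedModule)).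
intros s Hs. rewrite Rmin_left, Rmax_right in Hs by lra.
apply (cdiff_continuous_slice H (fun s => (s, y)) s (Cmod_horizontal y s)), Hd, Hs.
Qed.

Lemma ex_RInt_vertical (H : C -> C) (x c d : R) :
  c <= d -> (forall t, c <= t <= d -> cdiff H (x, t)) ->
  ex_RInt (fun t => Re (H (x, t))) c d.
Proof.
intros Hcd Hd. apply (ex_RInt_continuous (V := R_CompleteNormedModule)).
intros t Ht. rewrite Rmin_left, Rmax_right in Ht by lra.
apply (cdiff_continuous_slice H (fun t => (x, t)) t (Cmod_vertical x t)), Hd, Ht.
Qed.

Lemma cdiff_on_sub (a b c d a' b' c' d' : R) (H : C -> C) :
  cdiff_on a b c d H -> a <= a' -> b' <= b -> c <= c' -> d' <= d ->
  cdiff_on a' b' c' d' H.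
Proof. intros Hd H1 H2 H3 H4 z [Hz1 Hz2]. apply Hd. split; lra. Qed.

Lemma contour_Im_split (a b c d m k : R) (H : C -> C) :
  cdiff_on a b c d H -> a <= m <= b -> c <= k <= d ->
  contour_Im a b c d H =
  contour_Im a m c k H + contour_Im m b c k H +
  contour_Im a m k d H + contour_Im m b k d H.
Proof.
intros Hd Hm Hk.
assert (EH : forall y, c <= y <= d -> RInt (fun s => Im (H (s, y))) a b =
  RInt (fun s => Im (H (s, y))) a m + RInt (fun s => Im (H (s, y))) m b).
{ intros y Hy. symmetry. apply (RInt_Chasles (V := R_CompleteNormedModule));
    (apply ex_RInt_horizontal; [lra | intros s Hs; apply Hd; split; simpl; lra]). }
assert (EV : forall x, a <= x <= b -> RInt (fun t => Re (H (x, t))) c d =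
  RInt (fun t => Re (H (x, t))) c k + RInt (fun t => Re (H (x, t))) k d).
{ intros x Hx. symmetry. apply (RInt_Chasles (V := R_CompleteNormedModule));
    (apply ex_RInt_vertical; [lra | intros t Ht; apply Hd; split; simpl; lra]). }
unfold contour_Im. rewrite (EH c), (EH d), (EV a), (EV b) by lra. ring.
Qed.

Definition on_boundary (a b c d : R) (z : C) : Prop :=
  in_rectangle a b c d z /\
  (fst z = a \/ fst z = b \/ snd z = c \/ snd z = d).

(** Differentiability is asked on the boundary only, because the maximum principle applies this to 1
    / (z - xi), which has its pole inside. *)
Lemma contour_Im_plus (a b c d : R) (F G : C -> C) :
  a <= b -> c <= d ->
  (forall z, on_boundary a b c d z -> cdiff F z) ->
  (forall z, on_boundary a b c d z -> cdiff G z) ->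
  contour_Im a b c d (fun z => F z + G z)%C =
  contour_Im a b c d F + contour_Im a b c d G.
Proof.
intros Hab Hcd HF HG.
assert (EH : forall y, y = c \/ y = d ->
  RInt (fun s => Im (F (s, y) + G (s, y))%C) a b =
  RInt (fun s => Im (F (s, y))) a b + RInt (fun s => Im (G (s, y))) a b).
{ intros y Hy. apply (RInt_plus (V := R_CompleteNormedModule));
    (apply ex_RInt_horizontal; [lra | intros s Hs; (apply HF || apply HG)]);
    split; [split | | split |]; simpl; lra. }
assert (EV : forall x, x = a \/ x = b ->
  RInt (fun t => Re (F (x, t) + G (x, t))%C) c d =
  RInt (fun t => Re (F (x, t))) c d + RInt (fun t => Re (G (x, t))) c d).
{ intros x Hx. apply (RInt_plus (V := R_CompleteNormedModule));
    (apply ex_RInt_vertical; [lra | intros s Hs; (apply HF || apply HG)]);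
    split; [split | | split |]; simpl; lra. }
unfold contour_Im. rewrite (EH c), (EH d), (EV a), (EV b) by tauto. ring.
Qed.

Lemma contour_Im_bound (a b c d K : R) (H : C -> C) :
  a <= b -> c <= d ->
  (forall z, on_boundary a b c d z -> cdiff H z) ->
  (forall z, on_boundary a b c d z -> Cmod (H z) <= K) ->
  Rabs (contour_Im a b c d H) <= 2 * ((b - a) + (d - c)) * K.
Proof.
intros Hab Hcd Hd HK.
assert (EH : forall y, y = c \/ y = d ->
  Rabs (RInt (fun s => Im (H (s, y))) a b) <= (b - a) * K).
{ intros y Hy. apply abs_RInt_le_const; [lra | |].
  - apply ex_RInt_horizontal; [lra |].
    intros s Hs. apply Hd. split; [split |]; simpl; lra.
  - intros s Hs. eapply Rle_trans; [apply im_le_Cmod |].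
    apply HK. split; [split |]; simpl; lra. }
assert (EV : forall x, x = a \/ x = b ->
  Rabs (RInt (fun t => Re (H (x, t))) c d) <= (d - c) * K).
{ intros x Hx. apply abs_RInt_le_const; [lra | |].
  - apply ex_RInt_vertical; [lra |].
    intros s Hs. apply Hd. split; [split |]; simpl; lra.
  - intros s Hs. eapply Rle_trans; [apply re_le_Cmod |].
    apply HK. split; [split |]; simpl; lra. }
unfold contour_Im.
pose proof (EH c (or_introl eq_refl)) as E1. pose proof (EH d (or_intror eq_refl)) as E2.
pose proof (EV a (or_introl eq_refl)) as E3. pose proof (EV b (or_intror eq_refl)) as E4.
apply Rabs_le_between in E1, E2, E3, E4. apply Rabs_le_between. lra.
Qed.

Lemma RInt_affine (u v a b : R) :
  RInt (fun s => u + v * s) a b = u * (b - a) + v * (b ^ 2 - a ^ 2) / 2.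
Proof.
apply is_RInt_unique.
replace (u * (b - a) + v * (b ^ 2 - a ^ 2) / 2)
  with (minus (u * b + v * b ^ 2 / 2) (u * a + v * a ^ 2 / 2))
  by (unfold minus, plus, opp; simpl; field).
apply (is_RInt_derive (V := R_CompleteNormedModule) (fun s => u * s + v * s ^ 2 / 2)).
- intros x _. auto_derive; [exact I |]. field.
- intros x _. apply (ex_derive_continuous (fun s => u + v * s)). auto_derive. exact I.
Qed.

Lemma contour_Im_affine (a b c d : R) (z0 e l : C) :
  contour_Im a b c d (fun z => e + l * (z - z0))%C = 0.
Proof.
unfold contour_Im.
rewrite (RInt_ext (fun s => Im (e + l * ((s, c) - z0))%C)
  (fun s => (Im e + Re l * (c - Im z0) - Im l * Re z0) + Im l * s))
  by (intros; simpl; unfold Im, Re; ring).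
rewrite (RInt_ext (fun s => Im (e + l * ((s, d) - z0))%C)
  (fun s => (Im e + Re l * (d - Im z0) - Im l * Re z0) + Im l * s))
  by (intros; simpl; unfold Im, Re; ring).
rewrite (RInt_ext (fun t => Re (e + l * ((b, t) - z0))%C)
  (fun t => (Re e + Re l * (b - Re z0) + Im l * Im z0) + - Im l * t))
  by (intros; simpl; unfold Im, Re; ring).
rewrite (RInt_ext (fun t => Re (e + l * ((a, t) - z0))%C)
  (fun t => (Re e + Re l * (a - Re z0) + Im l * Im z0) + - Im l * t))
  by (intros; simpl; unfold Im, Re; ring).
rewrite !RInt_affine. field.
Qed.

(** A bound eps times the square of the half-perimeter is stable under adding up four quarters.
    Locally it holds because the affine part of [H] integrates to 0, while the remainder is at most
    eps / 2 times the half-perimeter on a contour of twice that length. *)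
Lemma goursat (a b c d : R) (H : C -> C) :
  a <= b -> c <= d -> cdiff_on a b c d H -> contour_Im a b c d H = 0.
Proof.
intros Hab Hcd Hd.
assert (Hsmall : forall eps, 0 < eps ->
  Rabs (contour_Im a b c d H) <= eps * ((b - a) + (d - c)) ^ 2).
{ intros eps He.
  cut (cdiff_on a b c d H ->
       Rabs (contour_Im a b c d H) <= eps * ((b - a) + (d - c)) ^ 2); [tauto |].
  apply (rectangle_induction (fun a b c d => cdiff_on a b c d H ->
    Rabs (contour_Im a b c d H) <= eps * ((b - a) + (d - c)) ^ 2)); try assumption.
  - clear. intros a b c d Hab Hcd H1 H2 H3 H4 Hd.
    rewrite (contour_Im_split a b c d ((a + b) / 2) ((c + d) / 2) H Hd) by lra.
    specialize (H1 ltac:(eapply cdiff_on_sub; [exact Hd | lra ..])).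
    specialize (H2 ltac:(eapply cdiff_on_sub; [exact Hd | lra ..])).
    specialize (H3 ltac:(eapply cdiff_on_sub; [exact Hd | lra ..])).
    specialize (H4 ltac:(eapply cdiff_on_sub; [exact Hd | lra ..])).
    apply Rabs_le_between in H1, H2, H3, H4. apply Rabs_le_between. nra.
  - intros x y Hx Hy.
    destruct (Hd (x, y)) as [l Hl]; [split; assumption |].
    destruct (proj1 (cderiv_eps _ _ _) Hl (eps / 2) ltac:(lra)) as [delta [Hdel Hw]].
    exists (delta / 2). split; [lra |].
    intros a' b' c' d' Ha Hb Hc Hd' Hs1 Hs2 Hdr.
    set (A := fun z => (H (x, y) + l * (z - (x, y)))%C).
    assert (HA : forall z, cdiff A z).
    { intros z. apply cdiff_plus; [apply cdiff_const |].
      apply cdiff_mult; [apply cdiff_const |].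
      apply cdiff_minus; [apply cdiff_id | apply cdiff_const]. }
    assert (HHA : cdiff_on a' b' c' d' (fun z => H z - A z)%C).
    { intros z Hz. apply cdiff_minus; [apply Hdr, Hz | apply HA]. }
    assert (E : contour_Im a' b' c' d' H = contour_Im a' b' c' d' (fun z => H z - A z)%C).
    { transitivity (contour_Im a' b' c' d' (fun z => (H z - A z) + A z)%C).
      - unfold contour_Im.
        rewrite !(RInt_ext (fun _ => Im (H _ - A _ + A _)%C) (fun _ => Im (H _)))
          by (intros; simpl; unfold Im; simpl; ring).
        rewrite !(RInt_ext (fun _ => Re (H _ - A _ + A _)%C) (fun _ => Re (H _)))
          by (intros; simpl; unfold Re; simpl; ring).
        reflexivity.
      - rewrite contour_Im_plus;
          [| lra | lra | intros z [Hz _]; exact (HHA z Hz) | intros z _; apply HA].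
        unfold A at 2. rewrite contour_Im_affine. ring. }
    rewrite E.
    eapply Rle_trans; [apply (contour_Im_bound _ _ _ _ (eps / 2 * ((b' - a') + (d' - c'))));
      [lra | lra | intros z [Hz _]; exact (HHA z Hz) |] | right; field].
    intros [s t] [[Hs Ht] _]. simpl in Hs, Ht.
    assert (Hm : Cmod ((s, t) - (x, y))%C <= (b' - a') + (d' - c')).
    { eapply Rle_trans; [apply Cmod_le_sum |]. simpl.
      apply Rplus_le_compat; apply Rabs_le_between; lra. }
    unfold A. replace (H (s, t) - (H (x, y) + l * ((s, t) - (x, y))))%C
      with (H (s, t) - H (x, y) - l * ((s, t) - (x, y)))%C by ring.
    eapply Rle_trans; [apply Hw; lra |].
    apply Rmult_le_compat_l; lra. }
destruct (Req_dec (contour_Im a b c d H) 0) as [|Hne]; [assumption | exfalso].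
apply Rabs_pos_lt in Hne.
set (D := (b - a + (d - c)) ^ 2) in *.
assert (0 <= D) by (unfold D; apply pow2_ge_0).
specialize (Hsmall (Rabs (contour_Im a b c d H) / (2 * (D + 1)))).
assert (0 < Rabs (contour_Im a b c d H) / (2 * (D + 1))) by (apply Rdiv_lt_0_compat; lra).
specialize (Hsmall H1).
assert (Rabs (contour_Im a b c d H) / (2 * (D + 1)) * (2 * (D + 1)) = Rabs (contour_Im a b c d H))
  by (field; lra).
nra.
Qed.

(** * The maximum modulus principle *)

(** For g / (z - xi), differentiability at [xi] would need second-order information on g. The square
    needs only the first derivative l: the quotient is l^2 (z - xi) up to a small error, and its
    value at [xi] is 0 whatever the inverse of 0 is. *)
Lemma cdiff_square_div (g : C -> C) (xi z : C) :
  g xi = 0 -> cdiff g z -> cdiff (fun w => g w ^ 2 * / (w - xi))%C z.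
Proof.
intros H0 Hg. destruct (classic (z = xi)) as [-> | Hne].
- destruct Hg as [l Hl]. exists (l * l)%C. apply cderiv_eps. intros eps He.
  pose proof (Cmod_ge_0 l) as Hml.
  set (e := Rmin 1 (eps / (1 + 2 * Cmod l))).
  assert (Hq : 0 < eps / (1 + 2 * Cmod l)) by (apply Rdiv_lt_0_compat; lra).
  assert (He0 : 0 < e) by (apply Rmin_pos; lra).
  assert (He1 : e <= 1) by apply Rmin_l.
  assert (He2 : e * (1 + 2 * Cmod l) <= eps).
  { apply Rle_trans with (eps / (1 + 2 * Cmod l) * (1 + 2 * Cmod l)).
    - apply Rmult_le_compat_r; [lra | apply Rmin_r].
    - right; field; lra. }
  destruct (proj1 (cderiv_eps _ _ _) Hl e He0) as [delta [Hd Hw]].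
  exists delta. split; [exact Hd |]. intros w Hwd. specialize (Hw w Hwd).
  rewrite H0 in Hw |- *.
  destruct (classic (w = xi)) as [-> | Hwx].
  { rewrite H0. replace (xi - xi)%C with (RtoC 0) by ring.
    replace (0 ^ 2 * / 0 - 0 ^ 2 * / 0 - l * l * 0)%C with (RtoC 0) by ring.
    rewrite Cmod_0. lra. }
  assert (Hn : (w - xi)%C <> 0).
  { intros E. apply Hwx. replace w with ((w - xi) + xi)%C by ring. rewrite E. ring. }
  assert (Hm : 0 < Cmod (w - xi)) by (apply Cmod_gt_0; exact Hn).
  replace (0 ^ 2 * / (xi - xi))%C with (RtoC 0) by ring.
  (* With r the first-order remainder of g and h = w - xi, g^2 - l^2 h^2 = r (r + 2 l h). *)
  replace (g w ^ 2 * / (w - xi) - 0 - l * l * (w - xi))%C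
    with ((g w - 0 - l * (w - xi)) * ((g w - 0 - l * (w - xi)) + 2 * l * (w - xi))
          / (w - xi))%C by (field; exact Hn).
  set (r := (g w - 0 - l * (w - xi))%C) in *.
  rewrite Cmod_div, Cmod_mult by exact Hn.
  apply Rle_div_l; [exact Hm |].
  assert (Ht : Cmod (r + 2 * l * (w - xi))%C <= (1 + 2 * Cmod l) * Cmod (w - xi)).
  { eapply Rle_trans; [apply Cmod_triangle |].
    rewrite !Cmod_mult, Cmod_R, Rabs_pos_eq by lra. nra. }
  eapply Rle_trans.
  { apply Rmult_le_compat; [apply Cmod_ge_0 | apply Cmod_ge_0 | exact Hw | exact Ht]. }
  nra.
- apply cdiff_mult; [apply cdiff_pow, Hg |].
  apply (cdiff_comp (fun w => / w)%C (fun w => w - xi)%C).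
  + apply cdiff_inv. intros E. apply Hne.
    replace z with ((z - xi) + xi)%C by ring. rewrite E. ring.
  + apply cdiff_minus; [apply cdiff_id | apply cdiff_const].
Qed.

Lemma cdiff_Cinv_shift (xi z : C) : z <> xi -> cdiff (fun w => / (w - xi))%C z.
Proof.
intros Hne. apply (cdiff_comp (fun w => / w)%C (fun w => w - xi)%C).
- apply cdiff_inv. intros E. apply Hne.
  replace z with ((z - xi) + xi)%C by ring. rewrite E. ring.
- apply cdiff_minus; [apply cdiff_id | apply cdiff_const].
Qed.

Lemma boundary_distance (a b c d : R) (xi : C) :
  a < fst xi < b -> c < snd xi < d ->
  exists r, 0 < r /\ forall z, on_boundary a b c d z -> r <= Cmod (z - xi).
Proof.
intros H1 H2.
set (r := Rmin (Rmin (fst xi - a) (b - fst xi)) (Rmin (snd xi - c) (d - snd xi))).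
assert (E1 : r <= fst xi - a) by (unfold r; eapply Rle_trans; apply Rmin_l).
assert (E2 : r <= b - fst xi) by (unfold r; eapply Rle_trans; [apply Rmin_l | apply Rmin_r]).
assert (E3 : r <= snd xi - c) by (unfold r; eapply Rle_trans; [apply Rmin_r | apply Rmin_l]).
assert (E4 : r <= d - snd xi) by (unfold r; eapply Rle_trans; apply Rmin_r).
exists r. split; [repeat apply Rmin_pos; lra |].
intros z [_ Hz].
pose proof (re_le_Cmod (z - xi)) as Hr. pose proof (im_le_Cmod (z - xi)) as Hi.
unfold Re in Hr. unfold Im in Hi. simpl in Hr, Hi.
apply Rabs_le_between in Hr, Hi. lra.
Qed.

(** Each side contributes the angle under which it is seen from [xi], so all four contributions are
    positive. Positivity replaces the exact value 2 pi. *)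
Lemma contour_Im_inv_pos (a b c d : R) (xi : C) :
  a < fst xi < b -> c < snd xi < d ->
  0 < contour_Im a b c d (fun z => / (z - xi))%C.
Proof.
intros H1 H2. destruct xi as [x y]. simpl in H1, H2.
assert (HP : forall u v, v <> 0 -> 0 < u ^ 2 + v ^ 2) by (intros; nra).
assert (HH : forall t, t <> y -> exists D : R -> R,
  (forall s, 0 < D s) /\ (forall s, continuous (fun s => (t - y) * / D s) s) /\
  forall s, Im (/ ((s, t) - (x, y)))%C = - ((t - y) * / D s)).
{ intros t Ht. exists (fun s => (s - x) ^ 2 + (t - y) ^ 2).
  assert (HD : forall s, 0 < (s - x) ^ 2 + (t - y) ^ 2) by (intros s; apply HP; lra).
  split; [exact HD | split].
  - intros s. apply (ex_derive_continuous (fun s => (t - y) * / ((s - x) ^ 2 + (t - y) ^ 2))).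
    auto_derive. specialize (HD s). simpl in HD. lra.
  - intros s. specialize (HD s). unfold Im. simpl. simpl in HD. field. lra. }
assert (HV : forall s, s <> x -> exists D : R -> R,
  (forall t, 0 < D t) /\ (forall t, continuous (fun t => (s - x) * / D t) t) /\
  forall t, Re (/ ((s, t) - (x, y)))%C = (s - x) * / D t).
{ intros s Hs. exists (fun t => (t - y) ^ 2 + (s - x) ^ 2).
  assert (HD : forall t, 0 < (t - y) ^ 2 + (s - x) ^ 2) by (intros t; apply HP; lra).
  split; [exact HD | split].
  - intros t. apply (ex_derive_continuous (fun t => (s - x) * / ((t - y) ^ 2 + (s - x) ^ 2))).
    auto_derive. specialize (HD t). simpl in HD. lra.
  - intros t. specialize (HD t). unfold Re. simpl. simpl in HD. field. lra. }
assert (Hpos : forall (k : R) (D : R -> R) u v, u < v -> 0 < k -> (forall s, 0 < D s) ->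
  (forall s, continuous (fun s => k * / D s) s) -> 0 < RInt (fun s => k * / D s) u v).
{ intros k D u v Huv Hk HD Hc. apply RInt_gt_0; [exact Huv | | intros; apply Hc].
  intros s _. apply Rmult_lt_0_compat; [exact Hk | apply Rinv_0_lt_compat, HD]. }
assert (Hopp : forall (k : R) (D : R -> R) u v,
  (forall s, continuous (fun s => k * / D s) s) ->
  RInt (fun s => - (k * / D s)) u v = - RInt (fun s => k * / D s) u v).
{ intros k D u v Hc. apply (RInt_opp (V := R_CompleteNormedModule)).
  apply (ex_RInt_continuous (V := R_CompleteNormedModule)). intros; apply Hc. }
assert (Hopp' : forall (k : R) (D : R -> R),
  (forall s, continuous (fun s => k * / D s) s) ->
  (forall s, continuous (fun s => - k * / D s) s)).
{ intros k D Hc s. apply (continuous_ext (fun s => opp (k * / D s))).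
  - intros; unfold opp; simpl; ring.
  - apply (continuous_opp (V := R_NormedModule)), Hc. }
assert (Hneg : forall (k : R) (D : R -> R) u v, u < v -> k < 0 -> (forall s, 0 < D s) ->
  (forall s, continuous (fun s => k * / D s) s) -> RInt (fun s => k * / D s) u v < 0).
{ intros k D u v Huv Hk HD Hc.
  pose proof (Hpos (- k) D u v Huv ltac:(lra) HD (Hopp' k D Hc)) as Hp.
  rewrite (RInt_ext _ (fun s => - (k * / D s))) in Hp by (intros; simpl; ring).
  rewrite Hopp in Hp by exact Hc. lra. }
destruct (HH c ltac:(lra)) as [D1 [P1 [C1 I1]]].
destruct (HH d ltac:(lra)) as [D2 [P2 [C2 I2]]].
destruct (HV b ltac:(lra)) as [D3 [P3 [C3 I3]]].
destruct (HV a ltac:(lra)) as [D4 [P4 [C4 I4]]].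
unfold contour_Im.
rewrite (RInt_ext _ _ a b (fun s _ => I1 s)), (RInt_ext _ _ a b (fun s _ => I2 s)),
  (RInt_ext _ _ c d (fun s _ => I3 s)), (RInt_ext _ _ c d (fun s _ => I4 s)).
rewrite !Hopp by assumption.
pose proof (Hneg (c - y) D1 a b ltac:(lra) ltac:(lra) P1 C1).
pose proof (Hpos (d - y) D2 a b ltac:(lra) ltac:(lra) P2 C2).
pose proof (Hpos (b - x) D3 c d ltac:(lra) ltac:(lra) P3 C3).
pose proof (Hneg (a - x) D4 c d ltac:(lra) ltac:(lra) P4 C4).
lra.
Qed.

(* If |H| <= B < |H xi| on the boundary, put u = H / H xi.  The function
   (1 - u^n)^2 / (z - xi) has no singularity at xi, so Goursat's theorem applies
   to it directly; since u^n tends to 0 on the boundary, this forces the integral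
   of 1 / (z - xi) to vanish. *)
Lemma maximum_modulus (a b c d B : R) (H : C -> C) (xi : C) :
  a < fst xi < b -> c < snd xi < d -> cdiff_on a b c d H ->
  (forall z, on_boundary a b c d z -> Cmod (H z) <= B) ->
  Cmod (H xi) <= B.
Proof.
intros Hx Hy Hd HB.
destruct (Rle_or_lt (Cmod (H xi)) B) as [| Hlt]; [assumption | exfalso].
assert (HB0 : 0 <= B).
{ eapply Rle_trans; [apply Cmod_ge_0 | apply (HB (a, c))].
  split; [split |]; simpl; lra. }
assert (Hxi : H xi <> 0) by (apply Cmod_gt_0; lra).
destruct (boundary_distance a b c d xi Hx Hy) as [r [Hr Hdist]].
assert (Hne : forall z, on_boundary a b c d z -> z <> xi).
{ intros z Hz ->. specialize (Hdist _ Hz).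
  replace (xi - xi)%C with (RtoC 0) in Hdist by ring. rewrite Cmod_0 in Hdist. lra. }
set (q := B / Cmod (H xi)).
assert (Hq0 : 0 <= q) by (apply Rdiv_le_0_compat; lra).
assert (Hq1 : q < 1) by (apply Rlt_div_l; lra).
set (u := fun z => (H z * / H xi)%C).
assert (Hu : forall z, on_boundary a b c d z -> Cmod (u z) <= q).
{ intros z Hz. unfold u, q. rewrite Cmod_mult, Cmod_inv by exact Hxi.
  apply Rmult_le_compat_r; [left; apply Rinv_0_lt_compat; lra | apply HB, Hz]. }
assert (Hud : cdiff_on a b c d u).
{ intros z Hz. apply cdiff_mult; [apply Hd, Hz | apply cdiff_const]. }
pose proof (contour_Im_inv_pos a b c d xi Hx Hy) as HJ.
set (J := contour_Im a b c d (fun z => / (z - xi))%C) in HJ.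
set (L := 2 * ((b - a) + (d - c)) * (3 * / r)).
assert (HL : 0 < L).
{ unfold L. apply Rmult_lt_0_compat; [lra |].
  apply Rmult_lt_0_compat; [lra | apply Rinv_0_lt_compat, Hr]. }
assert (Hbound : forall n, J <= L * q ^ n).
{ intros n.
  (* As (1 - u^n)^2 = 1 + (u^{2n} - 2 u^n), this is what remains after splitting off 1 / (z - xi).
     It is at most 3 q^n / r on the boundary, which explains [L]. *)
  set (V := fun z => ((u z ^ n * u z ^ n - 2 * u z ^ n) * / (z - xi))%C).
  assert (HVd : forall z, on_boundary a b c d z -> cdiff V z).
  { intros z Hz. assert (Hun := cdiff_pow u n z (Hud z (proj1 Hz))).
    apply cdiff_mult; [| apply cdiff_Cinv_shift, Hne, Hz].
    apply cdiff_minus; apply cdiff_mult; try exact Hun. apply cdiff_const. }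
  assert (HW : contour_Im a b c d (fun z => (1 - u z ^ n) ^ 2 * / (z - xi))%C = 0).
  { apply goursat; [lra | lra |]. intros z Hz.
    apply (cdiff_square_div (fun z => 1 - u z ^ n)%C).
    - unfold u. rewrite Cinv_r by exact Hxi.
      rewrite Cpow_1_l. ring.
    - apply cdiff_minus; [apply cdiff_const | apply cdiff_pow, Hud, Hz]. }
  assert (E : contour_Im a b c d (fun z => (1 - u z ^ n) ^ 2 * / (z - xi))%C
    = J + contour_Im a b c d V).
  { unfold J. rewrite <- contour_Im_plus;
      [| lra | lra | intros z Hz; apply cdiff_Cinv_shift, Hne, Hz | exact HVd].
    assert (HE : forall z, ((1 - u z ^ n) ^ 2 * / (z - xi) = / (z - xi) + V z)%C)
      by (intros z; unfold V; ring).
    unfold contour_Im.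
    rewrite !(RInt_ext (fun _ => Im ((1 - u _ ^ n) ^ 2 * / (_ - xi))%C)
      (fun _ => Im (/ (_ - xi) + V _)%C)) by (intros; rewrite HE; reflexivity).
    rewrite !(RInt_ext (fun _ => Re ((1 - u _ ^ n) ^ 2 * / (_ - xi))%C)
      (fun _ => Re (/ (_ - xi) + V _)%C)) by (intros; rewrite HE; reflexivity).
    reflexivity. }
  assert (HV : Rabs (contour_Im a b c d V) <= 2 * ((b - a) + (d - c)) * (3 * / r * q ^ n)).
  { apply contour_Im_bound; [lra | lra | exact HVd |].
    intros z Hz. unfold V. rewrite Cmod_mult.
    assert (Hzx : (z - xi)%C <> 0).
    { apply Cmod_gt_0. specialize (Hdist _ Hz). lra. }
    rewrite Cmod_inv by exact Hzx.
    assert (Hun : Cmod (u z ^ n)%C <= q ^ n).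
    { rewrite Cmod_pow. apply pow_incr. split; [apply Cmod_ge_0 | apply Hu, Hz]. }
    assert (Hqn : q ^ n <= 1).
    { rewrite <- (pow1 n). apply pow_incr. lra. }
    assert (H3 : Cmod (u z ^ n * u z ^ n - 2 * u z ^ n)%C <= 3 * q ^ n).
    { replace (u z ^ n * u z ^ n - 2 * u z ^ n)%C
        with (u z ^ n * u z ^ n + - (2 * u z ^ n))%C by ring.
      eapply Rle_trans; [apply Cmod_triangle |].
      rewrite Cmod_opp, !Cmod_mult, Cmod_R, Rabs_pos_eq by lra.
      pose proof (Cmod_ge_0 (u z ^ n)). nra. }
    replace (3 * / r * q ^ n) with (3 * q ^ n * / r) by ring.
    apply Rmult_le_compat; [apply Cmod_ge_0 | | exact H3 |].
    - left. apply Rinv_0_lt_compat, Cmod_gt_0, Hzx.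
    - apply Rinv_le_contravar; [exact Hr | apply Hdist, Hz]. }
  rewrite HW in E. apply Rabs_le_between in HV. unfold L. lra. }
destruct (pow_lt_1_zero q ltac:(rewrite Rabs_pos_eq; lra) (J / L)) as [n Hn].
{ apply Rdiv_lt_0_compat; assumption. }
specialize (Hn n (le_n n)). specialize (Hbound n).
rewrite Rabs_pos_eq in Hn by (apply pow_le; lra).
apply Rlt_div_r in Hn; [lra | exact HL].
Qed.

(** * The logarithmic coordinate *)

(** The inverse of the global coordinate log z: the surface becomes the plane and a sector becomes a
    horizontal strip, where rectangles are the natural domains. *)
Definition log_chart (z : C) : logpt := (exp (fst z), snd z).

Definition cexp (z : C) : C := proj (log_chart z).

Lemma cexp_plus (z w : C) : cexp (z + w)%C = (cexp z * cexp w)%C.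
Proof.
destruct z as [s t], w as [s' t'].
unfold cexp, proj, log_chart, Cplus, Cmult; simpl.
rewrite exp_plus, cos_plus, sin_plus. f_equal; ring.
Qed.

Lemma Cmod_proj (z : logpt) : 0 <= fst z -> Cmod (proj z) = fst z.
Proof.
destruct z as [r t]. intros Hr. simpl in Hr. unfold Cmod, proj; simpl.
apply sqrt_lem_1; [nra | exact Hr |].
pose proof (sin2_cos2 t) as E. unfold Rsqr in E. nra.
Qed.

Lemma Cmod_cexp (z : C) : Cmod (cexp z) = exp (fst z).
Proof. apply Cmod_proj. left. apply exp_pos. Qed.

Lemma derivable_pt_lim_small (f : R -> R) (x l : R) :
  derivable_pt_lim f x l -> forall eps, 0 < eps -> exists delta, 0 < delta /\
    forall h, Rabs h < delta -> Rabs (f (x + h) - f x - l * h) <= eps * Rabs h.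
Proof.
intros Hf eps He. destruct (Hf eps He) as [delta Hd].
exists delta. split; [apply cond_pos |]. intros h Hh.
destruct (Req_dec h 0) as [-> | Hn].
- rewrite Rplus_0_r. replace (f x - f x - l * 0) with 0 by ring. rewrite Rabs_R0. lra.
- specialize (Hd h Hn Hh).
  replace (f (x + h) - f x - l * h) with (((f (x + h) - f x) / h - l) * h)
    by (field; exact Hn).
  rewrite Rabs_mult. apply Rmult_le_compat_r; [apply Rabs_pos | lra].
Qed.

Lemma cexp_derivative_0 (eps : R) :
  0 < eps -> exists delta, 0 < delta /\
    forall z, Cmod z < delta -> Cmod (cexp z - 1 - z) <= eps * Cmod z.
Proof.
(* Real and imaginary parts each contribute an error of at most 3 e |z|. *)
intros He. set (e := eps / 6). assert (Hee : 0 < e) by (unfold e; lra).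
destruct (derivable_pt_lim_small _ _ _ derivable_pt_lim_exp_0 (Rmin 1 e)) as [d1 [Hd1 H1]];
  [apply Rmin_pos; lra |].
destruct (derivable_pt_lim_small _ _ _ (derivable_pt_lim_sin 0) e Hee) as [d2 [Hd2 H2]].
destruct (derivable_pt_lim_small _ _ _ (derivable_pt_lim_cos 0) e Hee) as [d3 [Hd3 H3]].
rewrite ?exp_0, ?sin_0, ?cos_0 in *.
exists (Rmin (Rmin d1 d2) (Rmin d3 (Rmin (/ 2) (e / 2)))). split.
{ repeat apply Rmin_pos; lra. }
intros [s t] Hz.
pose proof (Rle_trans _ _ _ (Rmax_l _ _) (Rmax_Cmod (s, t))) as Hs.
pose proof (Rle_trans _ _ _ (Rmax_r _ _) (Rmax_Cmod (s, t))) as Ht. simpl in Hs, Ht.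
set (r := Cmod (s, t)) in *.
assert (Hr1 : r < d1) by (eapply Rlt_le_trans; [exact Hz | eapply Rle_trans; apply Rmin_l]).
assert (Hr2 : r < d2)
  by (eapply Rlt_le_trans; [exact Hz | eapply Rle_trans; [apply Rmin_l | apply Rmin_r]]).
assert (Hr3 : r < d3)
  by (eapply Rlt_le_trans; [exact Hz | eapply Rle_trans; [apply Rmin_r | apply Rmin_l]]).
assert (Hr4 : r < Rmin (/ 2) (e / 2))
  by (eapply Rlt_le_trans; [exact Hz | eapply Rle_trans; apply Rmin_r]).
assert (Hr5 := Rlt_le_trans _ _ _ Hr4 (Rmin_l _ _)).
assert (Hr6 := Rlt_le_trans _ _ _ Hr4 (Rmin_r _ _)).
specialize (H1 s ltac:(lra)). specialize (H2 t ltac:(lra)). specialize (H3 t ltac:(lra)).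
rewrite Rplus_0_l in H1, H2, H3.
pose proof (Rabs_pos s) as Ps. pose proof (Rabs_pos t) as Pt.
assert (H1a : Rabs (exp s - 1 - 1 * s) <= 1 * Rabs s).
{ eapply Rle_trans; [exact H1 | apply Rmult_le_compat_r; [exact Ps | apply Rmin_l]]. }
assert (H1b : Rabs (exp s - 1 - 1 * s) <= e * Rabs s).
{ eapply Rle_trans; [exact H1 | apply Rmult_le_compat_r; [exact Ps | apply Rmin_r]]. }
assert (He1 : Rabs (exp s - 1) <= 2 * Rabs s).
{ replace (exp s - 1) with ((exp s - 1 - 1 * s) + s) by ring.
  eapply Rle_trans; [apply Rabs_triang |]. lra. }
assert (He2 : Rabs (exp s) <= 2).
{ replace (exp s) with ((exp s - 1) + 1) by ring.
  eapply Rle_trans; [apply Rabs_triang |]. rewrite Rabs_R1. lra. }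
eapply Rle_trans; [apply Cmod_le_sum |].
assert (HA : Rabs (exp s * cos t - 1 - s) <= 3 * e * r).
{ replace (exp s * cos t - 1 - s)
    with (exp s * (cos t - 1 - - 0 * t) + (exp s - 1 - 1 * s)) by ring.
  eapply Rle_trans; [apply Rabs_triang |]. rewrite Rabs_mult.
  assert (Rabs (exp s) * Rabs (cos t - 1 - - 0 * t) <= 2 * (e * Rabs t))
    by (apply Rmult_le_compat; try apply Rabs_pos; assumption). nra. }
assert (HB : Rabs (exp s * sin t - t) <= 3 * e * r).
{ replace (exp s * sin t - t)
    with (exp s * (sin t - 0 - 1 * t) + (exp s - 1) * t) by ring.
  eapply Rle_trans; [apply Rabs_triang |]. rewrite !Rabs_mult.
  assert (Rabs (exp s) * Rabs (sin t - 0 - 1 * t) <= 2 * (e * Rabs t))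
    by (apply Rmult_le_compat; try apply Rabs_pos; assumption).
  assert (Rabs (exp s - 1) * Rabs t <= e * Rabs t)
    by (apply Rmult_le_compat_r; [apply Rabs_pos | lra]). nra. }
replace (fst (cexp (s, t) - 1 - (s, t))%C) with (exp s * cos t - 1 - s) by (simpl; ring).
replace (snd (cexp (s, t) - 1 - (s, t))%C) with (exp s * sin t - t) by (simpl; ring).
replace eps with (6 * e) by (unfold e; field). lra.
Qed.

Lemma cderiv_cexp (z : C) : cderiv cexp z (cexp z).
Proof.
apply cderiv_eps. intros eps He.
assert (Hp : 0 < Cmod (cexp z)) by (rewrite Cmod_cexp; apply exp_pos).
destruct (cexp_derivative_0 (eps / Cmod (cexp z))) as [d [Hd Hw]];
  [apply Rdiv_lt_0_compat; assumption |].
exists d. split; [exact Hd |]. intros w Hwz. specialize (Hw (w - z)%C Hwz).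
replace w with (z + (w - z))%C at 1 by ring. rewrite cexp_plus.
replace (cexp z * cexp (w - z) - cexp z - cexp z * (w - z))%C
  with (cexp z * (cexp (w - z) - 1 - (w - z)))%C by ring.
rewrite Cmod_mult. eapply Rle_trans; [apply Rmult_le_compat_l; [lra | exact Hw] |].
right. field. lra.
Qed.

(** A chain rule: the difference quotient of [f] is taken relative to [proj], so it has to be
    multiplied by that of [cexp]. The derivative of [cexp] does not vanish, hence cexp w differs
    from cexp z for w near z and the division is legitimate. *)
Lemma cdiff_log_chart (U : logpt -> Prop) (f : logpt -> C) (z : C) :
  holomorphic_on U f -> U (log_chart z) -> cdiff (fun w => f (log_chart w)) z.
Proof.
intros Hf HU. destruct (Hf _ HU) as [l Hl].
exists (l * cexp z)%C. apply cderiv_eps. intros eps He.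
set (e := Cmod (cexp z)).
assert (Hp : 0 < e) by (unfold e; rewrite Cmod_cexp; apply exp_pos).
pose proof (Cmod_ge_0 l) as Hml.
assert (He1 : 0 < eps / (6 * e)) by (apply Rdiv_lt_0_compat; lra).
set (e2 := Rmin (e / 2) (eps / (2 * (1 + Cmod l)))).
assert (Hq : 0 < eps / (2 * (1 + Cmod l))) by (apply Rdiv_lt_0_compat; lra).
assert (He2 : 0 < e2) by (apply Rmin_pos; lra).
assert (He2a : e2 <= e / 2) by apply Rmin_l.
assert (He2b : Cmod l * e2 <= eps / 2).
{ apply Rle_trans with (Cmod l * (eps / (2 * (1 + Cmod l)))).
  - apply Rmult_le_compat_l; [exact Hml | apply Rmin_r].
  - apply Rle_trans with ((1 + Cmod l) * (eps / (2 * (1 + Cmod l)))).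
    + apply Rmult_le_compat_r; lra.
    + right; field; lra. }
destruct (proj1 (cderiv_eps _ _ _) (cderiv_cexp z) e2 He2) as [d1 [Hd1 H1]].
destruct (Hl _ (locally_ball l (mkposreal _ He1))) as [d2 H2].
destruct (derivable_pt_lim_small _ _ _ (derivable_pt_lim_exp (fst z)) 1 Rlt_0_1)
  as [d3 [Hd3 H3]].
assert (Hez : 0 < 1 + exp (fst z)) by (pose proof (exp_pos (fst z)); lra).
assert (Hd2 : 0 < d2 / (1 + exp (fst z)))
  by (apply Rdiv_lt_0_compat; [apply cond_pos | exact Hez]).
exists (Rmin (Rmin d1 d3) (Rmin d2 (d2 / (1 + exp (fst z))))). split.
{ repeat apply Rmin_pos; try assumption. apply cond_pos. }
intros w Hw.
assert (Hw1 : Cmod (w - z) < d1)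
  by (eapply Rlt_le_trans; [exact Hw | eapply Rle_trans; apply Rmin_l]).
assert (Hw3 : Cmod (w - z) < d3)
  by (eapply Rlt_le_trans; [exact Hw | eapply Rle_trans; [apply Rmin_l | apply Rmin_r]]).
assert (Hw2 : Cmod (w - z) < d2)
  by (eapply Rlt_le_trans; [exact Hw | eapply Rle_trans; [apply Rmin_r | apply Rmin_l]]).
assert (Hw4 : Cmod (w - z) < d2 / (1 + exp (fst z)))
  by (eapply Rlt_le_trans; [exact Hw | eapply Rle_trans; apply Rmin_r]).
clear Hw.
destruct (classic (w = z)) as [-> | Hne].
{ replace (z - z)%C with (RtoC 0) by ring. rewrite Cmod_0, Rmult_0_r.
  replace (f (log_chart z) - f (log_chart z) - l * cexp z * 0)%C with (RtoC 0) by ring.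
  rewrite Cmod_0. lra. }
pose proof (re_le_Cmod (w - z)) as Hr. pose proof (im_le_Cmod (w - z)) as Hi.
assert (Hm : 0 < Cmod (w - z)).
{ apply Cmod_gt_0. intros E. apply Hne. replace w with ((w - z) + z)%C by ring.
  rewrite E. ring. }
specialize (H1 w Hw1).
change (Rabs (fst w - fst z) <= Cmod (w - z)) in Hr.
change (Rabs (snd w - snd z) <= Cmod (w - z)) in Hi.
assert (HD : Cmod (cexp w - cexp z) <= (e + e2) * Cmod (w - z)).
{ replace (cexp w - cexp z)%C
    with ((cexp w - cexp z - cexp z * (w - z)) + cexp z * (w - z))%C by ring.
  eapply Rle_trans; [apply Cmod_triangle |]. rewrite Cmod_mult. fold e. lra. }
assert (HD0 : (cexp w - cexp z)%C <> 0).
{ intros E. rewrite E in H1.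
  replace (0 - cexp z * (w - z))%C with (- (cexp z * (w - z)))%C in H1 by ring.
  rewrite Cmod_opp, Cmod_mult in H1. fold e in H1. nra. }
assert (HB : Cmod ((f (log_chart w) - f (log_chart z)) / (cexp w - cexp z) - l)%C
             <= 2 * (eps / (6 * e))).
{ assert (Hball : ball (log_chart z) d2 (log_chart w)).
  { split; simpl.
    - change (Rabs (exp (fst w) - exp (fst z)) < d2).
      specialize (H3 (fst w - fst z) ltac:(lra)).
      replace (fst z + (fst w - fst z)) with (fst w) in H3 by ring.
      replace (exp (fst w) - exp (fst z))
        with ((exp (fst w) - exp (fst z) - exp (fst z) * (fst w - fst z))
              + exp (fst z) * (fst w - fst z)) by ring.
      eapply Rle_lt_trans; [apply Rabs_triang |].
      rewrite Rabs_mult, (Rabs_pos_eq (exp (fst z))) by (left; apply exp_pos).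
      apply Rlt_div_r in Hw4; [| exact Hez].
      pose proof (exp_pos (fst z)). nra.
    - change (Rabs (snd w - snd z) < d2). lra. }
  assert (Hneq : log_chart w <> log_chart z).
  { intros E. apply Hne. injection E as E1 E2. apply exp_inv in E1.
    destruct w, z; simpl in *; congruence. }
  specialize (H2 _ Hball Hneq).
  (* Balls of the product uniform structure on C are squares, whence the factor sqrt 2. *)
  apply C_NormedModule_mixin_compat2 in H2.
  change (Cmod ((f (log_chart w) - f (log_chart z)) / (cexp w - cexp z) - l)%C
          < sqrt 2 * (eps / (6 * e))) in H2.
  assert (sqrt 2 <= 2).
  { rewrite <- (sqrt_pow2 2) at 2 by lra. apply sqrt_le_1; lra. }
  eapply Rle_trans; [left; exact H2 |]. apply Rmult_le_compat_r; lra. }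
replace (f (log_chart w) - f (log_chart z) - l * cexp z * (w - z))%C
  with (((f (log_chart w) - f (log_chart z)) / (cexp w - cexp z) - l) * (cexp w - cexp z)
        + l * (cexp w - cexp z - cexp z * (w - z)))%C by (field; exact HD0).
eapply Rle_trans; [apply Cmod_triangle |]. rewrite !Cmod_mult.
assert (E1 : Cmod ((f (log_chart w) - f (log_chart z)) / (cexp w - cexp z) - l)%C
  * Cmod (cexp w - cexp z) <= 2 * (eps / (6 * e)) * ((3 / 2 * e) * Cmod (w - z))).
{ apply Rmult_le_compat; try apply Cmod_ge_0; [exact HB |].
  eapply Rle_trans; [exact HD |]. apply Rmult_le_compat_r; lra. }
replace (2 * (eps / (6 * e)) * (3 / 2 * e * Cmod (w - z))) with (eps / 2 * Cmod (w - z)) in E1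
  by (field; lra).
assert (E2 : Cmod l * Cmod (cexp w - cexp z - cexp z * (w - z))%C
             <= eps / 2 * Cmod (w - z)).
{ eapply Rle_trans; [apply Rmult_le_compat_l; [exact Hml | exact H1] |].
  rewrite <- Rmult_assoc. apply Rmult_le_compat_r; lra. }
lra.
Qed.

(** * The two-constants estimate in a sector *)

(* On the imaginary axis the real part is at most 1, and nonpositive for
   |w| >= 4 b, yet at a real point x >= b it is still of size b / x: the weight
   1/2 < 1 keeps the leading term at infinity on the real axis, while 4 * 1/2 > 1
   makes the tail on the imaginary axis negative. *)
Definition bump (b : R) (w : C) : C :=
  (RtoC b * / (w + RtoC b) - RtoC (b / 2) * / (w + RtoC (4 * b)))%C.

Lemma Re_bump (b : R) (w : C) :
  0 < b -> 0 <= fst w ->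
  Re (bump b w) = b * (fst w + b) / ((fst w + b) ^ 2 + snd w ^ 2)
    - b / 2 * (fst w + 4 * b) / ((fst w + 4 * b) ^ 2 + snd w ^ 2).
Proof.
intros Hb Hw. destruct w as [x y]. unfold bump, Re. simpl in *.
field. split; nra.
Qed.

Lemma Re_bump_le (b : R) (w : C) :
  0 < b -> 0 <= fst w ->
  Re (bump b w) <= b * (fst w + b) / ((fst w + b) ^ 2 + snd w ^ 2).
Proof.
intros Hb Hw. rewrite Re_bump by assumption.
assert (0 <= b / 2 * (fst w + 4 * b) / ((fst w + 4 * b) ^ 2 + snd w ^ 2)); [| lra].
apply Rdiv_le_0_compat; nra.
Qed.

Lemma Re_bump_le_1 (b : R) (w : C) : 0 < b -> 0 <= fst w -> Re (bump b w) <= 1.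
Proof.
intros Hb Hw. eapply Rle_trans; [apply Re_bump_le; assumption |].
apply Rle_div_l; nra.
Qed.

Lemma Re_bump_le_inv (b rho : R) (w : C) :
  0 < b -> 0 <= fst w -> 0 < rho -> fst w ^ 2 + snd w ^ 2 = rho ^ 2 ->
  Re (bump b w) <= b / rho.
Proof.
intros Hb Hw Hr E. eapply Rle_trans; [apply Re_bump_le; assumption |].
assert (Hx : fst w <= rho) by nra.
apply Rle_div_l; [nra |]. unfold Rdiv. rewrite !Rmult_assoc.
apply Rmult_le_compat_l; [lra |].
apply Rmult_le_reg_l with rho; [exact Hr |].
rewrite <- Rmult_assoc, Rinv_r, Rmult_1_l by lra. nra.
Qed.

Lemma Re_bump_nonpos (b y : R) : 0 < b -> 4 * b <= Rabs y -> Re (bump b (0, y)) <= 0.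
Proof.
intros Hb Hy. rewrite Re_bump by (simpl; lra). simpl fst; simpl snd.
assert (Hy2 : 16 * b ^ 2 <= y ^ 2).
{ rewrite <- (pow2_abs y). nra. }
assert (E : b * (0 + b) / ((0 + b) ^ 2 + y ^ 2)
  - b / 2 * (0 + 4 * b) / ((0 + 4 * b) ^ 2 + y ^ 2)
  = - (b ^ 2 * (y ^ 2 - 14 * b ^ 2)) / ((b ^ 2 + y ^ 2) * (16 * b ^ 2 + y ^ 2))).
{ field. split; nra. }
rewrite E. apply Rle_div_l; [apply Rmult_lt_0_compat; nra |].
assert (0 <= b ^ 2 * (y ^ 2 - 14 * b ^ 2)) by (apply Rmult_le_pos; nra). lra.
Qed.

Lemma Re_bump_real (b x : R) : 0 < b -> b <= x -> b / (4 * x) <= Re (bump b (x, 0)).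
Proof.
intros Hb Hx. rewrite Re_bump by (simpl; lra). simpl fst; simpl snd.
replace (b * (x + b) / ((x + b) ^ 2 + 0 ^ 2)
  - b / 2 * (x + 4 * b) / ((x + 4 * b) ^ 2 + 0 ^ 2))
  with (b / (x + b) - b / 2 / (x + 4 * b)) by (field; lra).
assert (H1 : b / 2 / (x + 4 * b) <= b / 2 / (x + b)).
{ apply Rmult_le_compat_l; [lra |]. apply Rinv_le_contravar; lra. }
assert (H2 : b / (4 * x) <= b / 2 / (x + b)).
{ replace (b / (4 * x)) with (b / 2 / (2 * x)) by (field; lra).
  apply Rmult_le_compat_l; [lra |]. apply Rinv_le_contravar; lra. }
assert (b / (x + b) = 2 * (b / 2 / (x + b))) by (field; lra). lra.
Qed.

Lemma cdiff_bump (b : R) (w : C) : 0 < b -> 0 <= fst w -> cdiff (bump b) w.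
Proof.
intros Hb Hw.
assert (Hinv : forall k, 0 < k -> cdiff (fun z => / (z + RtoC k))%C w).
{ intros k Hk. apply (cdiff_comp (fun z => / z)%C (fun z => z + RtoC k)%C).
  - apply cdiff_inv. intros E. apply (f_equal fst) in E. simpl in E. lra.
  - apply cdiff_plus; [apply cdiff_id | apply cdiff_const]. }
apply (cdiff_minus (fun z => RtoC b * / (z + RtoC b))%C
  (fun z => RtoC (b / 2) * / (z + RtoC (4 * b)))%C);
  (apply cdiff_mult; [apply cdiff_const | apply Hinv; lra]).
Qed.

Lemma exp_le (x y : R) : x <= y -> exp x <= exp y.
Proof. intros [H | ->]; [left; apply exp_increasing, H | right; reflexivity]. Qed.

Lemma exp_pow (x : R) (n : nat) : exp x ^ n = exp (INR n * x).
Proof.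
induction n as [|n IH].
- simpl. rewrite Rmult_0_l, exp_0. reflexivity.
- rewrite S_INR, <- tech_pow_Rmult, IH, <- exp_plus. f_equal. ring.
Qed.

(** In the coordinate z = log of the point, the maximum principle is applied to [g] divided by the
    m-th power and multiplied by exp (n bump), with the bump read in the half-plane variable e^{z /
    beta}. Near the vertex the bound with mu^n compensates the bump, on the two rays the bump is
    nonpositive, and on the outer arc it is at most b / rho. At [x] it is at least b / (4 X), which
    is the gain. *)
Lemma sector_estimate (alpha beta K L mu x : R) (m n : nat) (g : logpt -> C) :
  0 < beta < alpha ->
  (forall z, Rabs (snd z) < alpha * PI / 2 -> cdiff (fun w => g (log_chart w)) z) ->
  0 < K -> 0 < mu -> 0 < x ->
  (forall z, on_surface z -> Rabs (snd z) <= beta * PI / 2 -> fst z < 1 ->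
     Cmod (g z) <= K * fst z ^ m /\ Cmod (g z) <= K * mu ^ n * fst z ^ (m + n)) ->
  L * x ^ m <= Cmod (g (x, 0)) ->
  - 1 - ln mu <= ln x -> (1 + ln x) / beta <= - ln 8 ->
  L * exp (INR n / 32 * exp ((- 1 - ln mu - ln x) / beta)) <= K.
Proof.
intros Hbeta Hg HK Hmu Hx Hbd Hlow Hsb Hsx.
pose proof PI_RGT_0 as HPI.
(* [sb] is the log-radius where mu |z| = 1 / e: below it the second bound gains e^{-n}, which
   absorbs the weight since Re bump <= 1. Beyond it the rays are mapped to imaginary numbers of
   modulus at least e^{sb / beta} = 4 b, where the bump is nonpositive. *)
set (sb := - 1 - ln mu) in *. set (sx := ln x) in *.
set (b := exp (sb / beta) / 4).
assert (Hb : 0 < b) by (unfold b; pose proof (exp_pos (sb / beta)); lra).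
set (th := beta * PI / 2) in *.
assert (Hth : 0 < th) by (unfold th; nra).
pose (pw := fun z : C => cexp (RtoC (/ beta) * z)).
pose (H := fun z : C => (g (log_chart z)
  * cexp (RtoC (INR n) * bump b (pw z) - RtoC (INR m) * z))%C).
assert (Hpw : forall z, pw z = (exp (fst z / beta) * cos (snd z / beta),
                                exp (fst z / beta) * sin (snd z / beta))).
{ intros [s t]. unfold pw, cexp, log_chart, proj. simpl.
  replace (/ beta * s - 0 * t) with (s / beta) by (field; lra).
  replace (/ beta * t + 0 * s) with (t / beta) by (field; lra). reflexivity. }
assert (Hre : forall z, Rabs (snd z) <= th -> 0 <= fst (pw z)).
{ intros z Hz. rewrite Hpw. simpl. apply Rmult_le_pos; [left; apply exp_pos |].
  apply Rabs_le_between in Hz.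
  assert (Rabs (snd z / beta) <= PI / 2).
  { replace (PI / 2) with (th / beta) by (unfold th; field; lra).
    apply Rabs_le_between. unfold Rdiv.
    pose proof (Rinv_0_lt_compat beta ltac:(lra)). split; nra. }
  apply Rabs_le_between in H0. apply cos_ge_0; lra. }
assert (HmH : forall z, Cmod (H z) = Cmod (g (log_chart z))
  * exp (INR n * Re (bump b (pw z)) - INR m * fst z)).
{ intros z. unfold H. rewrite Cmod_mult, Cmod_cexp. do 2 f_equal.
  unfold Re. destruct z as [s t]. simpl. ring. }
assert (Hmu' : mu = exp (- 1 - sb)).
{ unfold sb. replace (- 1 - (- 1 - ln mu)) with (ln mu) by ring.
  rewrite exp_ln by exact Hmu. reflexivity. }
assert (HU : forall z, Rabs (snd z) <= th -> fst z <= - 1 ->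
  Cmod (H z) <= K * exp (INR n * Re (bump b (pw z))) /\
  Cmod (H z) <= K * exp (INR n * (- 1 - sb + fst z + Re (bump b (pw z))))).
{ intros z Hz1 Hz2.
  destruct (Hbd (log_chart z)) as [B1 B2].
  { apply exp_pos. }
  { exact Hz1. }
  { simpl. rewrite <- exp_0. apply exp_increasing. lra. }
  simpl fst in B1, B2. rewrite Hmu' in B2. rewrite exp_pow in B1. rewrite !exp_pow in B2.
  rewrite HmH. split.
  - replace (INR n * Re (bump b (pw z)))
      with (INR m * fst z + (INR n * Re (bump b (pw z)) - INR m * fst z)) at 2 by ring.
    rewrite (exp_plus (INR m * fst z)), <- Rmult_assoc.
    apply Rmult_le_compat_r; [left; apply exp_pos | exact B1].
  - replace (INR n * (- 1 - sb + fst z + Re (bump b (pw z))))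
      with (INR n * (- 1 - sb) + INR (m + n) * fst z
            + (INR n * Re (bump b (pw z)) - INR m * fst z))
      by (rewrite plus_INR; ring).
    rewrite 2 exp_plus, <- !Rmult_assoc.
    apply Rmult_le_compat_r; [left; apply exp_pos | exact B2]. }
pose proof (pos_INR n) as Hn.
assert (HK1 : forall y, y <= 0 -> K * exp (INR n * y) <= K).
{ intros y Hy. rewrite <- (Rmult_1_r K) at 2. apply Rmult_le_compat_l; [lra |].
  rewrite <- exp_0. apply exp_le. nra. }
assert (Hsb8 : sx < - 1).
{ assert (0 < ln 8) by (rewrite <- ln_1; apply ln_increasing; lra).
  assert ((1 + sx) / beta * beta = 1 + sx) by (field; lra). nra. }
assert (Hexpb : forall s t, s <= t -> exp (s / beta) <= exp (t / beta)).
{ intros s t Hst. apply exp_le, Rmult_le_compat_r; [| exact Hst].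
  left. apply Rinv_0_lt_compat. lra. }
set (rho := exp (- 1 / beta)).
assert (Hrho : 0 < rho) by apply exp_pos.
assert (Hmax : Cmod (H (sx, 0)) <= K * exp (INR n * (b / rho))).
{ assert (HKr : K <= K * exp (INR n * (b / rho))).
  { rewrite <- (Rmult_1_r K) at 1. apply Rmult_le_compat_l; [lra |].
    assert (0 <= b / rho) by (apply Rdiv_le_0_compat; lra).
    pose proof (exp_ineq1_le (INR n * (b / rho))).
    assert (0 <= INR n * (b / rho)) by nra. lra. }
  (* The left side is at [sb - 1] because [sx] may equal [sb] and must be interior; the right side
     at -1 keeps the closed rectangle within |z| < 1. *)
  apply (maximum_modulus (sb - 1) (- 1) (- th) th).
  - simpl; lra.
  - simpl; lra.
  - intros z [Hz1 Hz2]. apply Rabs_le_between in Hz2.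
    apply cdiff_mult.
    + apply Hg. eapply Rle_lt_trans; [exact Hz2 |]. unfold th. nra.
    + apply (cdiff_comp cexp
        (fun z => RtoC (INR n) * bump b (pw z) - RtoC (INR m) * z)%C);
        [eexists; apply cderiv_cexp |].
      apply cdiff_minus; (apply cdiff_mult; [apply cdiff_const |]); [| apply cdiff_id].
      apply (cdiff_comp (bump b) pw); [apply cdiff_bump; [exact Hb | apply Hre, Hz2] |].
      apply (cdiff_comp cexp (fun z => RtoC (/ beta) * z)%C); [eexists; apply cderiv_cexp |].
      apply cdiff_mult; [apply cdiff_const | apply cdiff_id].
  - intros z [[Hz1 Hz2] Hz3]. apply Rabs_le_between in Hz2.
    destruct (HU z Hz2 (proj2 Hz1)) as [U1 U2].
    pose proof (Re_bump_le_1 b (pw z) Hb (Hre z Hz2)) as Hb1.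
    destruct (Rle_or_lt (fst z) sb) as [Hzs | Hzs].
    { eapply Rle_trans; [exact U2 |]. eapply Rle_trans; [apply HK1; lra | exact HKr]. }
    assert (Hcase : fst z = - 1 \/ snd z = - th \/ snd z = th) by lra.
    destruct Hcase as [E | E].
    + eapply Rle_trans; [exact U1 |]. apply Rmult_le_compat_l; [lra |].
      assert (Re (bump b (pw z)) <= b / rho).
      { apply Re_bump_le_inv; [exact Hb | apply Hre, Hz2 | exact Hrho |].
        rewrite Hpw, E. simpl fst; simpl snd. fold rho.
        pose proof (sin2_cos2 (snd z / beta)) as Es. unfold Rsqr in Es. nra. }
      apply exp_le. nra.
    + eapply Rle_trans; [exact U1 |]. eapply Rle_trans; [| exact HKr]. apply HK1.
      assert (Hy : exists y, pw z = (0, y) /\ Rabs y = exp (fst z / beta)).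
      { rewrite Hpw. exists (exp (fst z / beta) * sin (snd z / beta)).
        assert (Hang : snd z / beta = - (PI / 2) \/ snd z / beta = PI / 2).
        { unfold th in E. destruct E as [-> | ->]; [left | right]; field; lra. }
        destruct Hang as [-> | ->]; rewrite ?cos_neg, ?sin_neg, cos_PI2, sin_PI2;
          (split; [f_equal; ring |]).
        - rewrite Rabs_mult, Rabs_Ropp, Rabs_R1, Rmult_1_r.
          apply Rabs_pos_eq. left; apply exp_pos.
        - rewrite Rmult_1_r. apply Rabs_pos_eq. left; apply exp_pos. }
      destruct Hy as [y [-> Hy]]. apply Re_bump_nonpos; [exact Hb |].
      rewrite Hy. unfold b. specialize (Hexpb sb (fst z) ltac:(lra)). lra. }
set (X := exp (sx / beta)).
assert (HX : 0 < X) by apply exp_pos.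
assert (HbX : b <= X).
{ unfold b. specialize (Hexpb sb sx Hsb). fold X in Hexpb.
  pose proof (exp_pos (sb / beta)). lra. }
assert (Hpx : pw (sx, 0) = (X, 0)).
{ rewrite Hpw. simpl. unfold Rdiv at 2 4. rewrite Rmult_0_l, cos_0, sin_0. fold X.
  f_equal; ring. }
assert (HlowH : L * exp (INR n * (b / (4 * X))) <= Cmod (H (sx, 0))).
{ destruct (Rle_or_lt L 0) as [HL | HL].
  { pose proof (exp_pos (INR n * (b / (4 * X)))). pose proof (Cmod_ge_0 (H (sx, 0))). nra. }
  rewrite HmH, Hpx. simpl fst.
  replace (log_chart (sx, 0)) with (x, 0)
    by (unfold log_chart, sx; simpl; rewrite exp_ln by exact Hx; reflexivity).
  assert (Hxm : x ^ m = exp (INR m * sx)).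
  { rewrite <- exp_pow. unfold sx. rewrite exp_ln by exact Hx. reflexivity. }
  rewrite Hxm in Hlow.
  pose proof (Re_bump_real b X Hb HbX) as Hrb.
  apply Rle_trans with (L * exp (INR m * sx)
    * exp (INR n * Re (bump b (X, 0)) - INR m * sx)).
  - rewrite Rmult_assoc, <- exp_plus. apply Rmult_le_compat_l; [lra |].
    replace (INR m * sx + (INR n * Re (bump b (X, 0)) - INR m * sx))
      with (INR n * Re (bump b (X, 0))) by ring.
    apply exp_le. nra.
  - apply Rmult_le_compat_r; [left; apply exp_pos | exact Hlow]. }
(* This is the hypothesis with ln 8: the loss b / rho on the outer arc is then at most half of the
   gain b / (4 X). *)
assert (HXr : 8 * X <= rho).
{ unfold X, rho. rewrite <- (exp_ln 8) at 1 by lra. rewrite <- exp_plus.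
  assert (ln 8 + sx / beta <= - 1 / beta).
  { unfold Rdiv in *. lra. }
  apply exp_le. lra. }
assert (Hbr : b / rho <= b / (8 * X)).
{ apply Rmult_le_compat_l; [lra |]. apply Rinv_le_contravar; lra. }
assert (EX : exp ((sb - sx) / beta) = 4 * b / X).
{ unfold b, X. replace ((sb - sx) / beta) with (sb / beta + - (sx / beta)) by (field; lra).
  rewrite exp_plus, exp_Ropp. field. apply Rgt_not_eq, exp_pos. }
rewrite EX.
(* The surviving half of the gain, n b / (8 X), is n / 32 times 4 b / X, the ratio of the flattened
   radii of [sb] and [sx]. *)
replace (INR n / 32 * (4 * b / X)) with (INR n * (b / (8 * X))) by (field; lra).
set (e := exp (INR n * (b / (8 * X)))) in *.
assert (E4 : exp (INR n * (b / (4 * X))) = e * e).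
{ unfold e. rewrite <- exp_plus. f_equal. field. lra. }
assert (Er : exp (INR n * (b / rho)) <= e).
{ unfold e. apply exp_le. nra. }
rewrite E4 in HlowH.
assert (He : 0 < e) by apply exp_pos.
apply Rmult_le_reg_r with e; [exact He |]. nra.
Qed.

(** * The Baire argument and uniform interpolation of monomials *)

(* Baire's theorem in Cantor space: a failing choice of prefixes at every stage
   would converge to a sequence lying in none of the sets [F k]. *)
Lemma baire_bool (F : nat -> (nat -> bool) -> Prop) :
  (forall s, exists k, F k s) ->
  exists (k N : nat) (s : nat -> bool),
    forall s', (forall j, (j < N)%nat -> s' j = s j) ->
    forall P, exists s'', (forall j, (j < P)%nat -> s'' j = s' j) /\ F k s''.
Proof.
intros Hcov.
destruct (classic (exists (k N : nat) (s : nat -> bool),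
    forall s', (forall j, (j < N)%nat -> s' j = s j) ->
    forall P, exists s'', (forall j, (j < P)%nat -> s'' j = s' j) /\ F k s''))
  as [| Hno]; [assumption | exfalso].
pose (refines := fun k (x y : nat * (nat -> bool)) =>
  (fst x < fst y)%nat /\ (forall j, (j < fst x)%nat -> snd y j = snd x j) /\
  forall t, (forall j, (j < fst y)%nat -> t j = snd y j) -> ~ F k t).
assert (Hstep : forall k x, exists y, refines k x y).
{ intros k [N s]. apply NNPP. intros Hf. apply Hno. exists k, N, s.
  intros s' Hs' P. apply NNPP. intros Hn. apply Hf.
  (* This length exceeds N, so prefixes grow strictly, and is at least P, so no extension of the new
     prefix lies in [F k]. *)
  exists (S N + P, s')%nat. unfold refines; simpl. split; [lia | split; [exact Hs' |]].
  intros t Ht HF. apply Hn. exists t. split; [| exact HF].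
  intros j Hj. apply Ht. lia. }
pose (next := fun k x =>
  proj1_sig (constructive_indefinite_description _ (Hstep k x))).
assert (Hnext : forall k x, refines k x (next k x)).
{ intros k x. exact (proj2_sig (constructive_indefinite_description _ (Hstep k x))). }
pose (u := fix u n := match n with O => (0%nat, fun _ : nat => false) | S m => next m (u m) end).
assert (Hu : forall n, refines n (u n) (u (S n))) by (intros n; apply Hnext).
clearbody u. clear Hnext next.
assert (Hlen : forall n, (n <= fst (u n))%nat).
{ induction n as [|n IH]; [lia |]. pose proof (proj1 (Hu n)). lia. }
assert (Hagree : forall m n, (m <= n)%nat -> (fst (u m) <= fst (u n))%nat /\
  forall j, (j < fst (u m))%nat -> snd (u n) j = snd (u m) j).
{ intros m n Hmn. induction Hmn as [|n Hmn [IH1 IH2]]; [split; [lia | reflexivity] |].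
  destruct (Hu n) as [H1 [H2 _]]. split; [lia |].
  intros j Hj. rewrite H2 by lia. apply IH2, Hj. }
(* The prefix of stage S j is longer than j, so its entry j never changes afterwards. *)
destruct (Hcov (fun j => snd (u (S j)) j)) as [k Hk].
destruct (Hu k) as [_ [_ Hbad]]. apply (Hbad _) in Hk; [exact Hk |].
intros j Hj. pose proof (Hlen (S j)).
destruct (Nat.le_ge_cases j k) as [H1 | H1].
- symmetry. apply (proj2 (Hagree (S j) (S k) ltac:(lia))). lia.
- apply (proj2 (Hagree (S k) (S j) ltac:(lia))). lia.
Qed.

Lemma proper_subsector_narrower (gamma alpha r : R) :
  0 < gamma < alpha -> 0 < r -> proper_subsector 0 gamma r alpha.
Proof.
intros Hg Hr0. pose proof PI_RGT_0 as HPI.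
split; [lra | split; [exact Hr0 |]].
intros [s t] [Hr Hc]. split; [exact Hr |]. simpl.
assert (He : 0 < (alpha - gamma) * PI / 2) by nra.
destruct (Hc (ball ((s, t) : logpt) (mkposreal _ He)))
  as [[s' t'] [[_ Hb] [_ [Hw _]]]].
{ apply locally_ball. }
change (Rabs (t' - t) < (alpha - gamma) * PI / 2) in Hb. simpl in Hw.
apply Rabs_def2 in Hb. apply Rabs_def2 in Hw. apply Rabs_def1; lra.
Qed.

Lemma partial_sum_ext (a b : nat -> C) (p : nat) (z : C) :
  (forall j, (j < p)%nat -> a j = b j) -> partial_sum a p z = partial_sum b p z.
Proof.
intros H. induction p as [|p IH]; [reflexivity |].
simpl. rewrite IH by (intros; apply H; lia). rewrite H by lia. reflexivity.
Qed.

Lemma partial_sum_diff_monomial (a b : nat -> C) (p q : nat) (z : C) :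
  (p < q)%nat -> (forall j, (j < q)%nat -> j <> p -> a j = b j) ->
  (partial_sum a q z - partial_sum b q z = (a p - b p) * z ^ p)%C.
Proof.
intros Hpq H. induction q as [|q IH]; [lia |]. simpl.
destruct (Nat.eq_dec p q) as [-> | Hne].
- rewrite (partial_sum_ext a b) by (intros j Hj; apply H; lia). ring.
- rewrite (H q) by lia. rewrite <- IH by (try (intros; apply H); lia). ring.
Qed.

(** Surjectivity alone gives constants depending on the series; Baire makes one [k] serve a dense
    part of a cylinder. Subtracting the functions for two sequences that differ below q at [p] only
    leaves the monomial. Partial sums of order j <= p cancel, which bounds the difference itself,
    and the factor 2 counts the two functions. *)
Lemma monomial_interpolation (M : nat -> R) (alpha gamma : R) :
  (forall p, 0 < M p) -> 0 < gamma < alpha -> borel_surjective M alpha ->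
  exists k N : nat, (1 <= k)%nat /\ forall p q, (N <= p)%nat -> (p < q)%nat ->
  exists g : logpt -> C,
    (forall z, Rabs (snd z) < alpha * PI / 2 -> cdiff (fun w => g (log_chart w)) z) /\
    forall z, bounded_sector 0 gamma 1 z ->
      (forall j, (j <= p)%nat ->
         Cmod (g z) <= 2 * INR k * INR k ^ j * M j * fst z ^ j) /\
      Cmod (g z - RtoC (M p) * proj z ^ p)%C <= 2 * INR k * INR k ^ q * M q * fst z ^ q.
Proof.
intros HM Hg Hsurj.
pose (jet := fun (s : nat -> bool) j => if s j then RtoC (M j) else RtoC 0).
pose (F := fun k s => (1 <= k)%nat /\ exists f : logpt -> C,
  holomorphic_on (sector alpha) f /\
  forall z p, bounded_sector 0 gamma 1 z ->
    Cmod (f z - partial_sum (jet s) p (proj z))%C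
    <= INR k * INR k ^ p * M p * fst z ^ p).
destruct (baire_bool F) as [k [N [s Hs]]].
{ intros s. destruct (Hsurj (jet s)) as [f [[Hf _] Hb]].
  { exists 1. split; [lra |]. exists 1. intros p. rewrite pow1, Rmult_1_l.
    specialize (HM p). apply Rle_div_l; [exact HM |]. unfold jet.
    destruct (s p); rewrite Cmod_R, Rabs_pos_eq; lra. }
  destruct (Hb 0 gamma 1 (proper_subsector_narrower gamma alpha 1 Hg Rlt_0_1))
    as [CT [AT [HC [HA HT]]]].
  (* One integer dominates both constants, so that countably many sets cover all sequences. *)
  destruct (INR_unbounded (CT + AT)) as [k Hk].
  exists k. split.
  { destruct k; [simpl in Hk; lra | lia]. }
  exists f. split; [exact Hf |]. intros z p Hz.
  eapply Rle_trans; [apply HT, Hz |].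
  apply Rmult_le_compat_r; [apply pow_le; left; exact (proj1 Hz) |].
  apply Rmult_le_compat_r; [left; apply HM |].
  apply Rmult_le_compat; [lra | apply pow_le; lra | lra | apply pow_incr; lra]. }
assert (Hk1 : (1 <= k)%nat).
{ destruct (Hs s (fun _ _ => eq_refl) 0%nat) as [_ [_ [Hk _]]]. exact Hk. }
exists k, N. split; [exact Hk1 |]. intros p q HNp Hpq.
(* Only the first N entries are imposed by the cylinder; p >= N leaves entry p free to be
   switched. *)
pose (s0 := fun j => if (j <? N)%nat then s j else false).
pose (s1 := fun j => if (j =? p)%nat then true else s0 j).
assert (Hs0 : forall j, (j < N)%nat -> s0 j = s j).
{ intros j Hj. unfold s0. apply Nat.ltb_lt in Hj. rewrite Hj. reflexivity. }
assert (Hs1 : forall j, j <> p -> s1 j = s0 j).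
{ intros j Hj. unfold s1. apply Nat.eqb_neq in Hj. rewrite Hj. reflexivity. }
destruct (Hs s0 Hs0 q) as [t0 [Ht0 [_ [f0 [Hf0 B0]]]]].
destruct (Hs s1 ltac:(intros j Hj; rewrite Hs1 by lia; apply Hs0, Hj) q)
  as [t1 [Ht1 [_ [f1 [Hf1 B1]]]]].
assert (Hjet : forall j, (j < q)%nat -> j <> p -> jet t1 j = jet t0 j).
{ intros j Hj Hne. unfold jet. rewrite Ht0, Ht1, Hs1 by assumption. reflexivity. }
assert (Hjp : (jet t1 p - jet t0 p)%C = RtoC (M p)).
{ unfold jet. rewrite Ht0, Ht1 by exact Hpq. unfold s1, s0.
  rewrite Nat.eqb_refl. replace (p <? N)%nat with false by (symmetry; apply Nat.ltb_ge; lia).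
  ring. }
exists (fun z => f1 z - f0 z)%C. split.
{ intros z Hz.
  assert (HU : sector alpha (log_chart z)) by (split; [apply exp_pos | exact Hz]).
  apply (cdiff_minus (fun w => f1 (log_chart w)) (fun w => f0 (log_chart w)));
    eapply cdiff_log_chart; eassumption. }
intros z Hz. split.
- intros j Hj. specialize (B0 z j Hz). specialize (B1 z j Hz).
  rewrite (partial_sum_ext (jet t1) (jet t0)) in B1 by (intros; apply Hjet; lia).
  set (S0 := partial_sum (jet t0) j (proj z)) in *.
  replace (f1 z - f0 z)%C with ((f1 z - S0) + - (f0 z - S0))%C by ring.
  eapply Rle_trans; [apply Cmod_triangle |]. rewrite Cmod_opp. lra.
- specialize (B0 z q Hz). specialize (B1 z q Hz).
  rewrite <- Hjp, <- (partial_sum_diff_monomial (jet t1) (jet t0) p q) by assumption.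
  set (S0 := partial_sum (jet t0) q (proj z)) in *.
  set (S1 := partial_sum (jet t1) q (proj z)) in *.
  replace (f1 z - f0 z - (S1 - S0))%C with ((f1 z - S1) + - (f0 z - S0))%C by ring.
  eapply Rle_trans; [apply Cmod_triangle |]. rewrite Cmod_opp. lra.
Qed.

(** * Growth of the quotients *)

Lemma quotient_pos (M : nat -> R) (p : nat) : weight_sequence M -> 0 < quotient M p.
Proof. intros [HM _]. apply Rdiv_lt_0_compat; apply HM. Qed.

Lemma quotient_incr (M : nat -> R) (p q : nat) :
  weight_sequence M -> (p <= q)%nat -> quotient M p <= quotient M q.
Proof.
intros [HM [_ [Hc _]]] Hpq. induction Hpq as [|q Hpq IH]; [lra |].
eapply Rle_trans; [exact IH |]. unfold quotient.
specialize (Hc (S q) ltac:(lia)). replace (S q - 1)%nat with q in Hc by lia.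
replace (S q + 1)%nat with (S (S q)) in Hc by lia.
pose proof (HM q) as H0. pose proof (HM (S q)) as H1.
apply Rle_div_l; [exact H0 |]. unfold Rdiv.
apply Rmult_le_reg_r with (M (S q)); [exact H1 |].
replace (M (S (S q)) * / M (S q) * M q * M (S q)) with (M q * M (S (S q)))
  by (field; lra). nra.
Qed.

Lemma weight_bounds (M : nat -> R) (p n : nat) :
  weight_sequence M ->
  M p * quotient M p ^ n <= M (p + n)%nat <= M p * quotient M (p + n) ^ n.
Proof.
intros HW. pose proof (proj1 HW) as HM. induction n as [|n IH].
- rewrite Nat.add_0_r. simpl. lra.
- replace (p + S n)%nat with (S (p + n)) by lia.
  assert (E : M (S (p + n)) = M (p + n)%nat * quotient M (p + n))
    by (unfold quotient; field; apply Rgt_not_eq, HM).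
  assert (Q0 := quotient_pos M p HW). assert (Q1 := quotient_pos M (p + n) HW).
  assert (Q2 := quotient_incr M p (p + n) HW ltac:(lia)).
  assert (Q3 := quotient_incr M (p + n) (S (p + n)) HW ltac:(lia)).
  pose proof (pow_lt _ n Q0) as P0. pose proof (pow_lt _ n Q1) as P1. pose proof (HM p) as Mp.
  rewrite E. rewrite <- !tech_pow_Rmult. split.
  + rewrite (Rmult_comm (quotient M p)), <- Rmult_assoc.
    apply Rmult_le_compat; try lra. apply Rmult_le_pos; lra.
  + rewrite (Rmult_comm (quotient M (S (p + n)))), <- Rmult_assoc.
    apply Rmult_le_compat; try lra.
    * left. apply HM.
    * eapply Rle_trans; [apply IH |]. apply Rmult_le_compat_l; [lra |].
      apply pow_incr. lra.
Qed.

Lemma quotient_growth (M : nat -> R) (alpha beta : R) :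
  weight_sequence M -> 0 < beta < alpha -> borel_surjective M alpha ->
  exists (D : R) (N : nat), 0 < D /\ (1 <= N)%nat /\
    forall p q, (N <= p)%nat -> (2 * p < q)%nat ->
      INR (q - 2 * p) * exp ((ln (quotient M p) - ln (quotient M q)) / beta)
      <= D * INR p.
Proof.
intros HW Hbeta Hsurj. pose proof (proj1 HW) as HM. pose proof PI_RGT_0 as HPI.
(* An opening strictly between the two, because the estimate needs the bounds on the closed rays of
   the sector of opening beta. *)
destruct (monomial_interpolation M alpha ((alpha + beta) / 2) HM ltac:(lra) Hsurj)
  as [kn [N0 [Hkn Hg]]].
assert (Hk : 1 <= INR kn) by (apply (le_INR 1), Hkn).
set (k := INR kn) in *. set (A := 4 * k * k).
assert (HA : 1 <= A) by (unfold A; nra).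
assert (HlA : 0 <= ln A) by (rewrite <- ln_1; apply ln_le; lra).
assert (Hlk : 0 <= ln k) by (rewrite <- ln_1; apply ln_le; lra).
(* This threshold on m_p puts x = A / m_p below 1 and gives (1 + ln x) / beta <= - ln 8. *)
destruct (proj1 (is_lim_seq_p_infty_Reals _) (proj2 (proj2 (proj2 HW)))
  (exp (1 + ln A + beta * ln 8))) as [N1 HN1].
set (c := ln (2 * (2 * k + 1)) + 2 * ln k).
assert (Hc : 0 < c).
{ unfold c. assert (0 < ln (2 * (2 * k + 1))); [| lra].
  rewrite <- ln_1. apply ln_increasing; lra. }
exists (32 * exp ((1 + ln k + ln A) / beta) * c), (Nat.max 1 (Nat.max N0 N1)).
split; [pose proof (exp_pos ((1 + ln k + ln A) / beta)); nra | split; [lia |]].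
intros p q Hp Hpq. set (n := (q - 2 * p)%nat).
assert (Hn : (2 * p + n)%nat = q) by (unfold n; lia).
set (mp := quotient M p). set (mq := quotient M q).
assert (Hmp : 0 < mp) by apply quotient_pos, HW.
assert (Hmq : 0 < mq) by apply quotient_pos, HW.
assert (Hmpq : ln mp <= ln mq).
{ apply ln_le; [exact Hmp |]. apply quotient_incr; [exact HW | lia]. }
assert (Hbig : 1 + ln A + beta * ln 8 < ln mp).
{ rewrite <- (ln_exp (1 + ln A + beta * ln 8)). apply ln_increasing; [apply exp_pos |].
  apply HN1. lia. }
assert (H8 : 0 < ln 8) by (rewrite <- ln_1; apply ln_increasing; lra).
destruct (Hg (2 * p)%nat q ltac:(lia) Hpq) as [g [Hgd Hgb]].
set (x := A / mp).
assert (Hx : 0 < x) by (apply Rdiv_lt_0_compat; lra).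
assert (Hlx : ln x = ln A - ln mp) by (unfold x; rewrite ln_div by lra; reflexivity).
assert (Hx1 : x < 1).
{ apply ln_lt_inv; [exact Hx | lra |]. rewrite Hlx, ln_1. nra. }
assert (HM2p := HM (2 * p)%nat).
assert (Hkp : 1 <= k ^ (2 * p)) by (apply pow_R1_Rle; exact Hk).
assert (Hmono : forall z : logpt, 0 < fst z ->
  Cmod (RtoC (M (2 * p)%nat) * proj z ^ (2 * p))%C = M (2 * p)%nat * fst z ^ (2 * p)).
{ intros z Hz. rewrite Cmod_mult, Cmod_R, Cmod_pow, Cmod_proj by lra.
  rewrite Rabs_pos_eq by lra. reflexivity. }
(* In the first constant, 2 k comes from [g] and 1 from the monomial. The choice mu = k m_q comes
   from k^q M_q <= k^{2p} M_{2p} (k m_q)^n, where n = q - 2p. *)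
assert (Hest := sector_estimate alpha beta ((2 * k + 1) * k ^ (2 * p) * M (2 * p)%nat)
  (M (2 * p)%nat / 2) (k * mq) x (2 * p) n
  (fun z => g z - RtoC (M (2 * p)%nat) * proj z ^ (2 * p))%C Hbeta).
assert (Hfin : M (2 * p)%nat / 2 * exp (INR n / 32 * exp ((- 1 - ln (k * mq) - ln x) / beta))
               <= (2 * k + 1) * k ^ (2 * p) * M (2 * p)%nat).
{ apply Hest; clear Hest.
  - intros z Hz.
    apply (cdiff_minus (fun w => g (log_chart w))
      (fun w => RtoC (M (2 * p)%nat) * cexp w ^ (2 * p))%C); [apply Hgd, Hz |].
    apply cdiff_mult; [apply cdiff_const |]. apply cdiff_pow. eexists. apply cderiv_cexp.
  - apply Rmult_lt_0_compat; [nra | exact HM2p].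
  - nra.
  - exact Hx.
  - intros z Hz1 Hz2 Hz3.
    assert (HzT : bounded_sector 0 ((alpha + beta) / 2) 1 z).
    { split; [exact Hz1 | split; [| exact Hz3]]. rewrite Rminus_0_r. nra. }
    destruct (Hgb z HzT) as [G1 G2].
    assert (Hz0 : 0 < fst z) by exact Hz1.
    split.
    + unfold Cminus. eapply Rle_trans; [apply Cmod_triangle |].
      rewrite Cmod_opp, Hmono by exact Hz0.
      specialize (G1 (2 * p)%nat (le_n _)).
      pose proof (pow_lt _ (2 * p) Hz0) as Hzp.
      assert (0 <= (k ^ (2 * p) - 1) * (M (2 * p)%nat * fst z ^ (2 * p)))
        by (apply Rmult_le_pos; [lra | nra]). lra.
    + eapply Rle_trans; [exact G2 |]. rewrite Hn.
      apply Rmult_le_compat_r; [apply pow_le; lra |].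
      destruct (weight_bounds M (2 * p) n HW) as [_ HWb]. rewrite Hn in HWb. fold mq in HWb.
      rewrite <- Hn at 1. rewrite pow_add, Rpow_mult_distr.
      pose proof (pow_lt k n ltac:(lra)) as Hkn'. pose proof (pow_lt mq n Hmq) as Hmqn.
      apply Rle_trans with (2 * k * (k ^ (2 * p) * k ^ n) * (M (2 * p)%nat * mq ^ n)).
      * apply Rmult_le_compat_l; [| exact HWb].
        apply Rmult_le_pos; [lra |]. apply Rmult_le_pos; lra.
      * assert (0 <= k ^ (2 * p) * M (2 * p)%nat * (k ^ n * mq ^ n))
          by (repeat apply Rmult_le_pos; lra). lra.
  - assert (HzT : bounded_sector 0 ((alpha + beta) / 2) 1 (x, 0)).
    { split; [exact Hx | split; [| exact Hx1]]. simpl. rewrite Rminus_0_r, Rabs_R0. nra. }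
    destruct (Hgb (x, 0) HzT) as [G1 _]. specialize (G1 p ltac:(lia)). simpl fst in G1.
    specialize (Hmono (x, 0) Hx). simpl fst in Hmono.
    set (Q := (RtoC (M (2 * p)%nat) * proj (x, 0) ^ (2 * p))%C) in *.
    pose proof (Cmod_triangle (g (x, 0) - Q) (- g (x, 0))) as Ht.
    replace (g (x, 0) - Q + - g (x, 0))%C with (- Q)%C in Ht by ring.
    rewrite !Cmod_opp, Hmono in Ht.
    destruct (weight_bounds M p p HW) as [HWb _].
    replace (p + p)%nat with (2 * p)%nat in HWb by lia. fold mp in HWb.
    assert (Hxp := pow_lt x p Hx).
    (* Here m_p x = A = (4 k) k, and (4 k)^p >= 4 k requires p >= 1, whence the 1 in the threshold
       on p. *)
    assert (HAp : 4 * k * k ^ p <= mp ^ p * x ^ p).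
    { rewrite <- Rpow_mult_distr. replace (mp * x) with (4 * k * k) by (unfold x, A; field; lra).
      rewrite (Rpow_mult_distr (4 * k) k p).
      apply Rmult_le_compat_r; [apply pow_le; lra |].
      rewrite <- (pow_1 (4 * k)) at 1. apply Rle_pow; [lra | lia]. }
    assert (HMp := HM p).
    assert (4 * k * k ^ p * M p * x ^ p <= M (2 * p)%nat * x ^ (2 * p)).
    { replace (2 * p)%nat with (p + p)%nat at 2 by lia. rewrite pow_add.
      apply Rle_trans with (M p * mp ^ p * (x ^ p * x ^ p)).
      - assert (0 <= (mp ^ p * x ^ p - 4 * k * k ^ p) * (M p * x ^ p))
          by (apply Rmult_le_pos; nra). lra.
      - apply Rmult_le_compat_r; [nra | exact HWb]. }
    lra.
  - rewrite ln_mult, Hlx by lra. lra.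
  - rewrite Hlx. apply Rle_div_l; [lra |]. lra. }
clear Hest.
rewrite ln_mult, Hlx in Hfin by lra.
set (E := exp ((- 1 - (ln k + ln mq) - (ln A - ln mp)) / beta)) in *.
assert (Hexp : exp (INR n / 32 * E) <= 2 * (2 * k + 1) * k ^ (2 * p)).
{ apply Rmult_le_reg_l with (M (2 * p)%nat); [exact HM2p |]. lra. }
assert (Hln : INR n / 32 * E <= c * INR p).
{ rewrite <- (ln_exp (INR n / 32 * E)).
  eapply Rle_trans; [apply ln_le; [apply exp_pos | exact Hexp] |].
  rewrite ln_mult by lra. rewrite ln_pow by lra. unfold c. rewrite mult_INR. simpl (INR 2).
  assert (1 <= INR p) by (apply (le_INR 1); lia).
  assert (0 < ln (2 * (2 * k + 1))) by (rewrite <- ln_1; apply ln_increasing; lra). nra. }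
assert (HE : exp ((ln mp - ln mq) / beta) = exp ((1 + ln k + ln A) / beta) * E).
{ unfold E. rewrite <- exp_plus. f_equal. field. lra. }
rewrite HE. pose proof (exp_pos ((1 + ln k + ln A) / beta)) as He.
apply Rle_trans with (32 * exp ((1 + ln k + ln A) / beta) * (INR n / 32 * E)); [lra |].
rewrite Rmult_assoc. rewrite (Rmult_assoc 32), (Rmult_assoc 32).
rewrite (Rmult_assoc (exp _)).
apply Rmult_le_compat_l; [lra |]. apply Rmult_le_compat_l; [lra | exact Hln].
Qed.

(** For q <= 4 p monotonicity of the quotients suffices, since (q + 1) / (p + 1) is at most 4. For q
    > 4 p one has q + 1 <= 4 (q - 2 p), so the hypothesis gives the power beta of (q + 1) / (p + 1).
    Indices below [N] cost at most the constant (N + 1)^beta. *)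
Lemma quotient_almost_increasing (M : nat -> R) (beta D : R) (N : nat) :
  weight_sequence M -> 0 < beta -> 0 < D -> (1 <= N)%nat ->
  (forall p q, (N <= p)%nat -> (2 * p < q)%nat ->
     INR (q - 2 * p) * exp ((ln (quotient M p) - ln (quotient M q)) / beta)
     <= D * INR p) ->
  exists B, 0 <= B /\ forall p q, (p <= q)%nat ->
    ln (quotient M p) - beta * ln (INR p + 1)
    <= B + (ln (quotient M q) - beta * ln (INR q + 1)).
Proof.
intros HW Hb HD HN Hgrow.
assert (HlN : 0 <= ln (INR N + 1)).
{ rewrite <- ln_1. pose proof (pos_INR N). apply ln_le; lra. }
assert (Hl4 : 0 <= ln 4) by (rewrite <- ln_1; apply ln_le; lra).
assert (HlD : 0 <= ln (1 + D)) by (rewrite <- ln_1; apply ln_le; lra).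
assert (Hincr : forall p q, (p <= q)%nat -> ln (quotient M p) <= ln (quotient M q)).
{ intros p q Hpq. apply ln_le; [apply quotient_pos, HW | apply quotient_incr; assumption]. }
assert (Hlarge : forall p q, (N <= p)%nat -> (p <= q)%nat ->
  ln (quotient M p) - beta * ln (INR p + 1)
  <= beta * (ln (1 + D) + ln 4) + (ln (quotient M q) - beta * ln (INR q + 1))).
{ intros p q Hp Hpq. specialize (Hincr p q Hpq).
  assert (Hp1 : 1 <= INR p) by (apply (le_INR 1); lia).
  destruct (Nat.le_gt_cases q (4 * p)) as [Hq | Hq].
  - assert (ln (INR q + 1) <= ln 4 + ln (INR p + 1)).
    { apply le_INR in Hq. rewrite mult_INR in Hq. simpl in Hq. pose proof (pos_INR q).
      rewrite <- ln_mult by lra. apply ln_le; lra. }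
    nra.
  - specialize (Hgrow p q Hp ltac:(lia)).
    set (y := (ln (quotient M p) - ln (quotient M q)) / beta) in *.
    assert (Hy : ln (quotient M p) - ln (quotient M q) = beta * y)
      by (unfold y; field; lra).
    assert (Hn : INR (q - 2 * p) = INR q - 2 * INR p).
    { rewrite minus_INR, mult_INR by lia. simpl. ring. }
    apply le_INR in Hq. rewrite S_INR, mult_INR in Hq. simpl in Hq.
    assert (Hn0 : 0 < INR (q - 2 * p)) by lra.
    assert (H1 : ln (INR (q - 2 * p)) + y <= ln D + ln (INR p)).
    { rewrite <- (ln_exp y), <- !ln_mult by (try apply exp_pos; lra).
      apply ln_le; [| exact Hgrow]. apply Rmult_lt_0_compat; [exact Hn0 | apply exp_pos]. }
    assert (H2 : ln D <= ln (1 + D)) by (apply ln_le; lra).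
    assert (H3 : ln (INR p) <= ln (INR p + 1)) by (apply ln_le; lra).
    assert (H4 : ln (INR q + 1) <= ln 4 + ln (INR (q - 2 * p))).
    { rewrite <- ln_mult by lra. apply ln_le; lra. }
    assert (beta * y <= beta * (ln (1 + D) + ln 4 + ln (INR p + 1) - ln (INR q + 1)))
      by (apply Rmult_le_compat_l; lra). lra. }
exists (beta * (ln (1 + D) + ln 4 + ln (INR N + 1))). split; [nra |].
intros p q Hpq.
assert (HbN : 0 <= beta * ln (INR N + 1)) by nra.
assert (HbD : 0 <= beta * (ln (1 + D) + ln 4)) by nra.
destruct (Nat.le_gt_cases N p) as [Hp | Hp].
- specialize (Hlarge p q Hp Hpq). lra.
- assert (Hp0 : 0 <= beta * ln (INR p + 1)).
  { apply Rmult_le_pos; [lra |]. rewrite <- ln_1. pose proof (pos_INR p). apply ln_le; lra. }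
  destruct (Nat.le_gt_cases N q) as [Hq | Hq].
  + specialize (Hlarge N q (le_n N) Hq). specialize (Hincr p N ltac:(lia)). lra.
  + specialize (Hincr p q Hpq).
    assert (beta * ln (INR q + 1) <= beta * ln (INR N + 1)).
    { apply Rmult_le_compat_l; [lra |]. pose proof (pos_INR q).
      apply lt_INR in Hq. apply ln_le; lra. }
    lra.
Qed.

(** * From almost increasing to (P_beta), and the conclusion *)

Fixpoint running_max (u : nat -> R) (p : nat) : R :=
  match p with
  | O => u O
  | S n => Rmax (running_max u n) (u (S n))
  end.

Lemma running_max_incr (u : nat -> R) (p q : nat) :
  (p <= q)%nat -> running_max u p <= running_max u q.
Proof.
induction 1 as [|q _ IH]; [apply Rle_refl |].
eapply Rle_trans; [exact IH | apply Rmax_l].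
Qed.

Lemma running_max_ge (u : nat -> R) (p : nat) : u p <= running_max u p.
Proof. destruct p; [apply Rle_refl | apply Rmax_r]. Qed.

Lemma running_max_lub (u : nat -> R) (p : nat) (b : R) :
  (forall j, (j <= p)%nat -> u j <= b) -> running_max u p <= b.
Proof.
induction p as [|p IH]; intros H; simpl; [apply H; lia |].
apply Rmax_lub; [apply IH; intros; apply H; lia | apply H; lia].
Qed.

(** The least increasing majorant of m_p / (p + 1)^beta exceeds it by a factor of at most e^B,
    precisely because that sequence is almost increasing; multiplied back by (p + 1)^beta it is the
    required m'. *)
Lemma property_P_of_borel_surjective (M : nat -> R) (alpha beta : R) :
  weight_sequence M -> 0 < beta < alpha -> borel_surjective M alpha ->
  property_P M beta.
Proof.
intros HW Hbeta Hsurj.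
destruct (quotient_growth M alpha beta HW Hbeta Hsurj) as [D [N [HD [HN Hgrow]]]].
destruct (quotient_almost_increasing M beta D N HW ltac:(lra) HD HN Hgrow)
  as [B [HB0 HB]].
set (u := fun p => Rpower (INR p + 1) (- beta) * quotient M p).
assert (Hu : forall p, u p = exp (ln (quotient M p) - beta * ln (INR p + 1))).
{ intros p. unfold u, Rpower. rewrite <- (exp_ln (quotient M p)) at 1
    by (apply quotient_pos, HW). rewrite <- exp_plus. f_equal. ring. }
assert (Hinv : forall p, Rpower (INR p + 1) beta * Rpower (INR p + 1) (- beta) = 1).
{ intros p. rewrite <- Rpower_plus, Rplus_opp_r. apply Rpower_O.
  pose proof (pos_INR p). lra. }
assert (Hmu : forall p, quotient M p = Rpower (INR p + 1) beta * u p).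
{ intros p. unfold u. rewrite <- Rmult_assoc, Hinv. ring. }
assert (Hpos : forall p, 0 < Rpower (INR p + 1) beta) by (intros; apply exp_pos).
assert (HeB : 1 <= exp B) by (pose proof (exp_ineq1_le B); lra).
exists (fun p => Rpower (INR p + 1) beta * running_max u p), (exp B).
split; [exact HeB | split].
- intros p _. pose proof (quotient_pos M p HW) as Hq.
  split.
  + apply Rle_trans with (quotient M p).
    * rewrite <- (Rmult_1_l (quotient M p)) at 2. apply Rmult_le_compat_r; [lra |].
      rewrite <- Rinv_1. apply Rinv_le_contravar; lra.
    * rewrite (Hmu p). apply Rmult_le_compat_l; [left; apply Hpos | apply running_max_ge].
  + rewrite (Hmu p), <- Rmult_assoc, (Rmult_comm (exp B)), Rmult_assoc.
    apply Rmult_le_compat_l; [left; apply Hpos |].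
    apply running_max_lub. intros j Hj. rewrite !Hu, <- exp_plus. apply exp_le, HB, Hj.
- intros p q Hpq. rewrite <- !Rmult_assoc, !(Rmult_comm (Rpower _ (- beta))), !Hinv.
  rewrite !Rmult_1_l. apply running_max_incr, Hpq.
Qed.

Theorem theorem4p10 (M : nat -> R) (hM : weight_sequence M) :
  (forall alpha : R,
     0 < alpha ->
     ~ (exists n : nat, (1 <= n)%nat /\ alpha = INR n) ->
     borel_surjective M alpha ->
     Rbar_lt (Finite (IZR (Zfloor alpha))) (gamma_index M))
  /\
  ((forall gamma : R, surjectivity_set M gamma <-> 0 < gamma) ->
   gamma_index M = p_infty).
Proof.
assert (Hge : forall alpha beta, 0 < beta < alpha -> borel_surjective M alpha ->
  Rbar_le beta (gamma_index M)).
{ intros alpha beta Hb Hs. apply (proj1 (Lub_Rbar_correct (property_P M))).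
  exact (property_P_of_borel_surjective M alpha beta hM Hb Hs). }
split.
- intros alpha Ha Hni Hs. destruct (Zfloor_bound alpha) as [Hf1 Hf2].
  assert (Hf0 : 0 <= IZR (Zfloor alpha)).
  { apply IZR_le. apply Zfloor_lub. lra. }
  assert (Hf : IZR (Zfloor alpha) < alpha).
  { destruct Hf1 as [|E]; [assumption | exfalso]. apply Hni.
    exists (Z.to_nat (Zfloor alpha)).
    assert (En : INR (Z.to_nat (Zfloor alpha)) = alpha).
    { rewrite INR_IZR_INZ, Z2Nat.id; [exact E | apply le_IZR, Hf0]. }
    split; [| symmetry; exact En].
    destruct (Z.to_nat (Zfloor alpha)); [simpl in En; lra | lia]. }
  (* The midpoint of the floor and alpha is an admissible beta, strictly above the floor. *)
  eapply Rbar_lt_le_trans;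
    [| apply (Hge alpha ((IZR (Zfloor alpha) + alpha) / 2) ltac:(lra) Hs)].
  simpl. lra.
- intros Hall.
  assert (H : forall b, 0 < b -> Rbar_le b (gamma_index M)).
  { intros b Hb. apply (Hge (b + 1) b ltac:(lra)). apply Hall. lra. }
  destruct (gamma_index M) as [g | |]; [| reflexivity |].
  + specialize (H (Rabs g + 1)). simpl in H. pose proof (Rle_abs g).
    pose proof (Rabs_pos g). exfalso. lra.
  + exfalso. exact (H 1 Rlt_0_1).
Qed.
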